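(* Let $n\ge1$ and let $C=\mathcal{O}(1)$ be a constant. In the real vector search problem, one is given vectors $x_1,\ldots,x_C\in\mathbb{C}^{2^n}$ where, for one unknown index $k^*\in\{1,\ldots,C\}$, $x_{k^*}$ is sampled uniformly from the real unit sphere $\{x\in\mathbb{R}^{2^n}:\|x\|_2=1\}$ and each $x_i$ with $i\ne k^*$ is sampled (independently) uniformly from the complex unit sphere $\{x\in\mathbb{C}^{2^n}:\|x\|_2=1\}$; the goal is to identify $k^*$. Any quantum algorithm that has access to copies of the $n$-qubit states $|x_1\rangle,\ldots,|x_C\rangle$ (where $|x\rangle=\sum_i x_i|i\rangle$) requires $\Omega(2^{n/2})$ time to solve the real vector search problem.
   Context: A quantum algorithm with quantum state inputs may request any number of copies of each state $|x_1\rangle,\ldots,|x_C\rangle$, each copy having unit cost, and may then perform arbitrary quantum operations and measurements; its running time is at least the total number of copies it uses. ''Solving'' the problem means outputting the correct index $k^*$ with probability at least $0.9$, where the probability is over the random sampling of the vectors and the randomness of the algorithm, for each possible value of $k^*$. *)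

(* Defs.v *)
From HB Require Import structures.
From mathcomp Require Import all_boot all_order all_algebra.
From mathcomp Require Import all_classical all_reals all_analysis.
From mathcomp Require Import complex.

Set Implicit Arguments.
Unset Strict Implicit.
Unset Printing Implicit Defensive.

Import Order.TTheory GRing.Theory Num.Theory.
Local Open Scope classical_set_scope.
Local Open Scope ring_scope.

(* Vectors of C^N, encoded as N-tuples of (real part, imaginary part);
   N.-tuple (R * R) carries the product sigma-algebra (Borel on R^(2N)). *)
Definition vecR (R : realType) (N : nat) := (N.-tuple (R * R))%type.

Section Defs.
Variables (R : realType) (N : nat).

Definition cvec (v : vecR R N) (j : 'I_N) : R[i] :=
  Complex (tnth v j).1 (tnth v j).2.

Definition vec_of (z : 'I_N -> R[i]) : vecR R N :=
  [tuple (@complex.Re R (z j), @complex.Im R (z j)) | j < N].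

Definition sqnorm (v : vecR R N) : R :=
  \sum_(j < N) ((tnth v j).1 ^+ 2 + (tnth v j).2 ^+ 2).

Definition complex_sphere : set (vecR R N) := [set v | sqnorm v = 1].

Definition real_sphere : set (vecR R N) :=
  [set v | sqnorm v = 1 /\ forall j, (tnth v j).2 = 0].

Definition unitary (U : 'M[R[i]]_N) : Prop :=
  forall a b : 'I_N, \sum_(k < N) U a k * conjc (U b k) = (a == b)%:R.

Definition orthogonal (O : 'M[R]_N) : Prop :=
  forall a b : 'I_N, \sum_(k < N) O a k * O b k = (a == b)%:R.

Definition act_unitary (U : 'M[R[i]]_N) (v : vecR R N) : vecR R N :=
  vec_of (fun a => \sum_(b < N) U a b * cvec v b).

Definition act_orth (O : 'M[R]_N) (v : vecR R N) : vecR R N :=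
  [tuple (\sum_(b < N) O a b * (tnth v b).1, \sum_(b < N) O a b * (tnth v b).2)
   | a < N].

(* nu is the uniform (= unique unitarily invariant) probability distribution
   on the complex unit sphere *)
Definition uniform_complex_sphere (nu : set (vecR R N) -> \bar R) : Prop :=
  nu complex_sphere = 1%E /\
  forall U, unitary U -> forall A, measurable A ->
    nu (act_unitary U @^-1` A) = nu A.

(* nu is the uniform (= unique orthogonally invariant) probability
   distribution on the real unit sphere *)
Definition uniform_real_sphere (nu : set (vecR R N) -> \bar R) : Prop :=
  nu real_sphere = 1%E /\
  forall O, orthogonal O -> forall A, measurable A ->
    nu (act_orth O @^-1` A) = nu A.

End Defs.

Section Problem.
Variables (R : realType) (C N : nat).

Definition inputs := (C.-tuple (vecR R N))%type.

Definition marginal (P : set inputs -> \bar R) (i : 'I_C) :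
  set (vecR R N) -> \bar R :=
  fun A => P ((fun x : inputs => tnth x i) @^-1` A).

Definition independent_inputs (P : set inputs -> \bar R) : Prop :=
  forall A : 'I_C -> set (vecR R N), (forall i, measurable (A i)) ->
    fine (P [set x | forall i, A i (tnth x i)]) =
    \prod_(i < C) fine (P [set x | A i (tnth x i)]).

Definition rvs_distribution (kstar : 'I_C) (P : set inputs -> \bar R) : Prop :=
  independent_inputs P /\
  forall i, if i == kstar then uniform_real_sphere (marginal P i)
            else uniform_complex_sphere (marginal P i).

(* An algorithm using T copies: copy t is a copy of |x_(own t)>.
   The joint state lives in (C^N)^(tensor T), with computational basis
   indexed by functions 'I_T -> 'I_N. *)
Variables (T : nat) (own : 'I_T -> 'I_C).

Definition basis := {ffun 'I_T -> 'I_N}.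
Definition operator := basis -> basis -> R[i].

Definition psd (A : operator) : Prop :=
  (forall a b, A b a = conjc (A a b)) /\
  forall v : basis -> R[i],
    0 <= @complex.Re R (\sum_a \sum_b conjc (v a) * A a b * v b).

Definition POVM (M : 'I_C -> operator) : Prop :=
  (forall k, psd (M k)) /\
  forall a b, \sum_(k < C) M k a b = (a == b)%:R.

Definition joint_state (x : inputs) (a : basis) : R[i] :=
  \prod_(t < T) cvec (tnth x (own t)) (a t).

Definition outcome_prob (P : probability inputs R) (E : operator) : \bar R :=
  (\int[P]_x (@complex.Re R (\sum_a \sum_b conjc (joint_state x a) * E a b
                                 * joint_state x b))%:E)%E.

End Problem.

(* Main.v *)
Require Import Defs.
From HB Require Import structures.
From mathcomp Require Import all_boot all_order all_algebra.
From mathcomp Require Import all_classical all_reals all_analysis.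
From mathcomp Require Import measurable_realfun perm complex ring lra.
(* again, since MathComp's own [orthogonal] now shadows that of Defs *)
Import Defs.

(** Let psi be the joint state of the T copies and split its coordinates
    psi(a), a : 'I_T -> 'I_N with N = 2^n, into the injective a (chi) and the
    others (phi). Both sphere laws are invariant under real orthogonal maps.
    The 45 degree reflections bound the fourth moments of a coordinate by
    E sum_j |z_j|^4 <= 3/N, hence E |phi|^2 <= 3 T^2/N by the union bound over
    collisions a(s) = a(t). Sign changes kill E (conj psi(a) psi(b)) unless a
    and b use the same set of pairs (owner, index), in which case
    psi(a) = psi(b); coordinate permutations make E |psi(a)|^2 = q_k
    independent of the injective a. So, up to the error term, the success
    probability for k is at most 3/2 q_k X_k, where X_k is the sum of
    Re M_k(a, b) over such pairs, while q_k D <= 1 for the number D of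
    injective a and sum_k X_k = D. If T^2/N < 1/100, each X_k exceeds D/2,
    which is absurd as soon as there are two indices k.

    The sphere laws are images of Lebesgue measure restricted to a part of the
    unit ball; its invariance under a unitary map follows from the uniqueness
    of translation-invariant measures, because the ball is preserved. *)

Set Implicit Arguments.
Unset Strict Implicit.
Unset Printing Implicit Defensive.
Import Order.TTheory GRing.Theory Num.Theory.
Local Open Scope classical_set_scope.
Local Open Scope ring_scope.

(** * Measures promoted to sigma-finite measures and probabilities *)

Section bundling.
Context d (T : measurableType d) (R : realType).

(* The unused proof arguments let the HB instances below depend on them. *)
Definition with_sigma_finite (mu : {measure set T -> \bar R})
  (_ : sigma_finite setT mu) : set T -> \bar R := mu.

Definition with_total_mass_one (mu : {measure set T -> \bar R})
  (_ : mu setT = 1%E) : set T -> \bar R := mu.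

Section instances.
Variables (mu : {measure set T -> \bar R}) (sf : sigma_finite setT mu).
Variable (mu1 : mu setT = 1%E).

HB.instance Definition _ := Measure.on (with_sigma_finite sf).
HB.instance Definition _ :=
  @Measure_isSigmaFinite.Build d T R (with_sigma_finite sf) sf.

HB.instance Definition _ := Measure.on (with_total_mass_one mu1).
HB.instance Definition _ :=
  @Measure_isProbability.Build d T R (with_total_mass_one mu1) mu1.

End instances.

(** Turns a proof of sigma-finiteness into the structure that product measures and Tonelli's theorem
    ask for, with unchanged values. *)
Lemma bundle_sigma_finite (mu : {measure set T -> \bar R}) :
  sigma_finite setT mu ->
  exists nu : {sigma_finite_measure set T -> \bar R}, forall A, nu A = mu A.
Proof.
by move=> sf; exists [the {sigma_finite_measure set T -> \bar R} of
  with_sigma_finite sf].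
Qed.

Lemma bundle_probability (mu : {measure set T -> \bar R}) :
  mu setT = 1%E ->
  exists P : probability T R, forall A, P A = mu A.
Proof.
by move=> mu1; exists [the probability T R of with_total_mass_one mu1].
Qed.

End bundling.

(** * Pushforward measures *)

Section image.
Context d d' (T : measurableType d) (T' : measurableType d') (R : realType).

Lemma image_measure (mu : {measure set T -> \bar R}) (f : T -> T') :
  measurable_fun setT f ->
  exists nu : {measure set T' -> \bar R}, forall A, nu A = mu (f @^-1` A).
Proof.
move=> mf.
by exists (measure_function_pushforward__canonical__measure_function_Measure mu mf).
Qed.

Lemma preimage_measurable (f : T -> T') A :
  measurable_fun setT f -> measurable A -> measurable (f @^-1` A).
Proof. by move=> mf mA; rewrite -[X in measurable X]setTI; exact: mf. Qed.

End image.

(** * Finite products of sigma-finite measures on tuples *)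

Section tuple_measure.
Context d (T : measurableType d) (R : realType).
Local Open Scope ereal_scope.

Definition box n (A : 'I_n -> set T) : set (n.-tuple T) :=
  [set x | forall i, A i (tnth x i)].

Lemma boxE n (A : 'I_n -> set T) :
  box A = \bigcap_(i in [set: 'I_n]) ((@tnth n T)^~ i @^-1` A i).
Proof. by apply/seteqP; split => x /= h i; [move=> _|]; exact: h. Qed.

Lemma measurable_box n (A : 'I_n -> set T) :
  (forall i, measurable (A i)) -> measurable (box A).
Proof.
move=> mA; rewrite boxE; apply: fin_bigcap_measurable => [|i _].
  exact: finite_finset.
by apply: preimage_measurable; [exact: measurable_tnth|exact: mA].
Qed.

(** Coordinate preimages are boxes with [setT] elsewhere, and boxes are finite intersections of
    coordinate preimages. Boxes are moreover stable under intersection, as uniqueness of measures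
    requires. *)
Lemma measurable_tuple_boxes n :
  @measurable _ (n.-tuple T) =
  <<s [set box A | A in [set A | forall i, measurable (A i)]] >>.
Proof.
apply/seteqP; split.
- apply: smallest_sub; first exact: smallest_sigma_algebra.
  rewrite -bigcup_seq/= => X [i _ [A mA <-]].
  apply: sub_sigma_algebra.
  exists (fun j => if j == i then A else setT).
    by move=> j /=; case: ifP.
  rewrite setTI; apply/seteqP; split => x /= h.
    by have := h i; rewrite eqxx.
  by move=> j; case: eqP => // ->.
- apply: smallest_sub; first exact: sigma_algebra_measurable.
  by move=> X [A mA <-]; exact: measurable_box.
Qed.

(** The exhaustion behind uniqueness and sigma-finiteness. It increases in each coordinate, so that
    one common index, a maximum over the coordinates, captures a given tuple. *)
Lemma box_cover n (m : 'I_n -> {sigma_finite_measure set T -> \bar R}) :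
  exists G : nat -> 'I_n -> set T,
    [/\ forall k i, measurable (G k i), \bigcup_k box (G k) = setT &
        forall k, \prod_(i < n) m i (G k i) < +oo].
Proof.
have /choice[F hF] i : exists F : nat -> set T, [/\ \bigcup_k F k = setT,
    nondecreasing_seq F & forall k, measurable (F k) /\ m i (F k) < +oo].
  by have /sigma_finiteP[F [TF ndF Foo]] := sigma_finiteT (m i); exists F.
exists (fun k i => F i k); split.
- by move=> k i; have [_ _ /(_ k)[]] := hF i.
- apply/seteqP; split => // x _.
  have /choice[k hk] i : exists k, F i k (tnth x i).
    have [FT _ _] := hF i.
    have : [set: T] (tnth x i) by [].
    by rewrite -FT => -[k _ ?]; exists k.
  exists (\max_(i < n) k i)%N => // i.
  have [_ /(_ (k i) (\max_(i < n) k i)%N) ndF _] := hF i.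
  by have /subsetPset := ndF (leq_bigmax i); apply.
- move=> k; rewrite -ge0_fin_numE; last by apply: prode_ge0.
  apply: prode_fin_num => i _.
  by rewrite ge0_fin_numE//; have [_ _ /(_ k)[]] := hF i.
Qed.

Lemma box_measure_unique n (m : 'I_n -> {sigma_finite_measure set T -> \bar R})
    (mu1 mu2 : {measure set (n.-tuple T) -> \bar R}) :
  (forall A, (forall i, measurable (A i)) ->
    mu1 (box A) = \prod_(i < n) m i (A i)) ->
  (forall A, (forall i, measurable (A i)) ->
    mu2 (box A) = \prod_(i < n) m i (A i)) ->
  forall X, measurable X -> mu1 X = mu2 X.
Proof.
move=> h1 h2 X mX; have [G [mG coverG finG]] := box_cover m.
apply: (measure_unique [set box A | A in [set A | forall i, measurable (A i)]]
   (fun k => box (G k))) => //.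
- exact: measurable_tuple_boxes.
- move=> _ _ [A mA <-] [B mB <-]; exists (fun i => A i `&` B i).
    by move=> i /=; exact: measurableI.
  by apply/seteqP; split => x /=;
    [move=> h; split => i; have [] := h i | move=> [h h'] i; split].
- by move=> k; exists (G k) => // i /=.
- by move=> _ [A mA <-]; rewrite h1// h2.
- by move=> k; rewrite h1.
Qed.

Lemma box_cons n (A : 'I_n.+1 -> set T) (a : T) (x : n.-tuple T) :
  box A [tuple of a :: x] <-> A ord0 a /\ box (fun i => A (lift ord0 i)) x.
Proof.
split=> [h|[h0 h] i].
  by split=> [|i]; [exact: (h ord0)|have := h (lift ord0 i); rewrite tnthS].
by case: (unliftP ord0 i) => [j|] ->; rewrite ?tnthS//; exact: h.
Qed.

(** By induction on [n]: the product of the first measure with the one on [n]-tuples is pushed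
    forward along cons. *)
Lemma tuple_measure_exists n
    (m : 'I_n -> {sigma_finite_measure set T -> \bar R}) :
  exists mu : {sigma_finite_measure set (n.-tuple T) -> \bar R},
  forall A, (forall i, measurable (A i)) ->
    mu (box A) = \prod_(i < n) m i (A i).
Proof.
suff [mu hmu] : exists mu : {measure set (n.-tuple T) -> \bar R},
  forall A, (forall i, measurable (A i)) ->
    mu (box A) = \prod_(i < n) m i (A i).
  have [|nu hnu] := bundle_sigma_finite (mu := mu).
    have [G [mG coverG finG]] := box_cover m.
    exists (fun k => box (G k)) => // k.
    by split; [exact: measurable_box|rewrite hmu].
  by exists nu => A mA; rewrite hnu hmu.
elim: n m => [|n IH] m.
  (* The Dirac mass at the empty tuple gives the empty product [1]. *)
  exists [the measure _ _ of @dirac _ (0.-tuple T) [tuple] R] => A mA.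
  by rewrite big_ord0 /= diracE mem_set// => -[].
have [mu hmu] := IH (fun i => m (lift ord0 i)).
have [|nu hnu] := bundle_sigma_finite (mu := mu).
  have [G [mG coverG finG]] := box_cover (fun i => m (lift ord0 i)).
  exists (fun k => box (G k)) => // k.
  by split; [exact: measurable_box|rewrite hmu].
have [mu' hmu'] := image_measure [the measure _ _ of m ord0 \x nu]
  (measurable_cons measurable_fst measurable_snd).
exists mu' => A mA.
rewrite hmu' (_ : _ @^-1` _ = A ord0 `*` box (fun i => A (lift ord0 i))).
  rewrite [LHS]product_measure1E//; last exact: measurable_box.
  by rewrite hnu hmu// big_ord_recl.
by apply/seteqP; split=> -[a x] /= /box_cons.
Qed.

End tuple_measure.

(** * Uniqueness of translation-invariant measures *)

Section translation_invariance.
Context d (V : measurableType d) (R : realType).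
Variables (add : V -> V -> V) (opp : V -> V).
Hypothesis addC : commutative add.
Hypothesis addK : forall x y, add (add x y) (opp x) = y.
Hypothesis oppB : forall x y, add y (opp x) = opp (add x (opp y)).
Hypothesis measurable_add : measurable_fun setT (fun p : V * V => add p.1 p.2).
Hypothesis measurable_opp : measurable_fun setT opp.

Definition translation_invariant (mu : set V -> \bar R) :=
  forall y A, measurable A -> mu (add^~ y @^-1` A) = mu A.

Let measurable_sub :
  measurable_fun setT (fun p : V * V => add p.2 (opp p.1)).
Proof.
have h : measurable_fun setT (fun p : V * V => (p.2, opp p.1)).
  by apply: measurable_fun_pair => //; exact: measurableT_comp.
exact: (measurableT_comp measurable_add h).
Qed.

Local Open Scope ereal_scope.

(* Both sides are the [nu \x mu]-measure of [{(x, y) | x + y \in A, y \in B}],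
   up to the shear [(x, y) |-> (x, y - x)]. *)
Lemma translation_invariant_exchange
    (mu nu : {sigma_finite_measure set V -> \bar R}) A B :
  translation_invariant mu -> translation_invariant nu ->
  measurable A -> measurable B ->
  mu A * nu B = nu A * mu (opp @^-1` B).
Proof.
move=> tmu tnu mA mB.
pose E := [set p : V * V | A (add p.1 p.2) /\ B p.2].
pose E' := [set p : V * V | A p.2 /\ B (add p.2 (opp p.1))].
have mE : measurable E.
  apply: measurableI; first exact: (preimage_measurable measurable_add).
  exact: (preimage_measurable measurable_snd).
have mE' : measurable E'.
  apply: measurableI; first exact: (preimage_measurable measurable_snd).
  exact: (preimage_measurable measurable_sub).
have swapE X : measurable X ->
    \int[mu]_x nu (xsection X x) = \int[nu]_y mu (ysection X y).
  move=> mX; have := indic_fubini_tonelli mu nu mX.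
  by rewrite indic_fubini_tonelli_FE// indic_fubini_tonelli_GE.
have -> : mu A * nu B = \int[nu]_y mu (ysection E y).
  rewrite (eq_integral (fun y => mu A * (\1_B y)%:E)); last first.
    move=> y _; rewrite indicE ysectionE.
    case: (boolP (y \in B)) => [/set_mem|/negP/(contra_not (@mem_set _ B y))] yB.
      rewrite mule1 -(tmu y A)//; congr (mu _).
      by apply/seteqP; split => x //= -[].
    rewrite mule0 (_ : _ @^-1` _ = set0) ?measure0//.
    by apply/seteqP; split => x //= -[_ /yB].
  rewrite ge0_integralZl ?integral_indic ?setIT//.
  exact/measurable_EFinP/measurable_indic.
rewrite -swapE//.
have -> : \int[mu]_x nu (xsection E x) = \int[mu]_x nu (xsection E' x).
  apply: eq_integral => x _; rewrite -(tnu x (xsection E' x)).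
    congr (nu _); rewrite !xsectionE; apply/seteqP; split => y;
      by rewrite /E /E' /= (addC y x) addK.
  exact: measurable_xsection.
rewrite swapE//.
rewrite (eq_integral (fun y => (\1_A y)%:E * mu (opp @^-1` B))); last first.
  move=> y _; rewrite indicE ysectionE.
  case: (boolP (y \in A)) => [/set_mem|/negP/(contra_not (@mem_set _ A y))] yA.
    rewrite mul1e -(tmu (opp y) (opp @^-1` B)); last exact: preimage_measurable.
    by congr (mu _); apply/seteqP; split => x; rewrite /E' /= (oppB x y); tauto.
  rewrite mul0e (_ : _ @^-1` _ = set0) ?measure0//.
  by apply/seteqP; split => x //= -[/yA].
rewrite ge0_integralZr ?integral_indic ?setIT//.
exact/measurable_EFinP/measurable_indic.
Qed.

(** The exchange identity gives [mu K * nu B = nu K * mu (- B)] and, for [mu] with itself,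
    [mu K * mu B = mu K * mu (- B)]. The common value [mu K = nu K] is positive and finite, so it
    cancels. *)
Lemma translation_invariant_unique
    (mu nu : {sigma_finite_measure set V -> \bar R}) K :
  translation_invariant mu -> translation_invariant nu ->
  measurable K -> mu K = nu K -> 0 < mu K < +oo ->
  forall B, measurable B -> nu B = mu B.
Proof.
move=> tmu tnu mK munuK /andP[K0 Koo].
have Kfin : mu K \is a fin_num by rewrite ge0_fin_numE.
have simp a b : mu K * a = mu K * b -> a = b.
  move: K0; rewrite -(fineK Kfin) lte_fin; set k := fine _ => k0.
  move=> /(congr1 (fun z => (k^-1)%:E * z)).
  by rewrite !muleA -EFinM mulVf ?gt_eqF// !mul1e.
move=> B mB; apply: simp.
rewrite translation_invariant_exchange// -munuK.
by rewrite [RHS]translation_invariant_exchange.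
Qed.

(** The pushforward of [mu] along the additive bijection [L] is again translation invariant and
    agrees with [mu] on [K], so uniqueness applies. *)
Lemma translation_invariant_isometry
    (mu : {sigma_finite_measure set V -> \bar R}) (L L' : V -> V) K :
  translation_invariant mu ->
  measurable_fun setT L -> measurable_fun setT L' ->
  cancel L L' -> cancel L' L -> {morph L : x y / add x y} ->
  measurable K -> L @^-1` K = K -> 0 < mu K < +oo ->
  forall B, measurable B -> mu (L @^-1` B) = mu B.
Proof.
move=> tmu mL mL' LK L'K Ladd mK LKK K0 B mB.
have [nu0 hnu0] := image_measure mu mL.
have [|nu hnu] := bundle_sigma_finite (mu := nu0).
  have [F FT Foo] := sigma_finiteT mu.
  exists (fun k => L' @^-1` F k).
    by rewrite -preimage_bigcup -FT.
  move=> k; have [mF muF] := Foo k; split; first exact: preimage_measurable.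
  rewrite hnu0 (_ : _ @^-1` _ = F k)//.
  by apply/seteqP; split => x /=; rewrite LK.
rewrite -hnu0 -hnu (translation_invariant_unique (nu := nu) tmu _ mK)//.
(* Translating the pushforward by [y] amounts to translating [mu] by [L' y]. *)
- move=> y A mA; rewrite !hnu !hnu0.
  rewrite -[RHS](tmu (L' y) _ (preimage_measurable mL mA)).
  by congr (mu _); apply/seteqP; split => x /=; rewrite Ladd L'K.
- by rewrite hnu hnu0 LKK.
Qed.

End translation_invariance.

(** * Lebesgue measure on the line, the plane and C^N *)

Section vec_lebesgue.
Variable R : realType.
Local Open Scope ereal_scope.

(** Lebesgue measure lives on [measurableTypeR R]; the identity carries it to [R], over which [vecR]
    is built. A translate gives half-open intervals the same length, hence is the same measure. *)
Lemma line_measure_exists :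
  exists mu : {sigma_finite_measure set R -> \bar R},
    (forall (a : R) (A : set R), measurable A ->
       mu ((fun x => (x + a)%R) @^-1` A) = mu A) /\
    forall a b : R, (a <= b)%R -> mu `]a, b]%classic = (b - a)%:E.
Proof.
have [mu0 hmu0] := @image_measure _ _ (measurableTypeR R) R R
  lebesgue_measure (idfun : measurableTypeR R -> R) (@measurable_id _ _ setT).
have [|mu hmu] := bundle_sigma_finite (mu := mu0).
  have [F FT Foo] := sigma_finiteT (@lebesgue_measure R).
  by exists F => // k; have [mF Fk] := Foo k; split => //; rewrite hmu0.
have mu_itv (a b : R) : (a <= b)%R -> lebesgue_measure `]a, b]%classic = (b - a)%:E.
  by move=> ab; rewrite lebesgue_measure_itv/= lte_fin;
    move: ab; rewrite le_eqVlt => /predU1P[->|->]; rewrite ?ltxx ?subrr.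
exists mu; split; last by move=> a b ab; rewrite hmu hmu0; exact: mu_itv.
move=> a A mA; rewrite !hmu !hmu0.
have ma : measurable_fun [set: measurableTypeR R]
    ((fun x => (x + a)%R) : measurableTypeR R -> measurableTypeR R).
  have : measurable_fun [set: R] (fun x : R => (x + a)%R).
    exact: measurable_funD.
  by [].
have [nu hnu] := image_measure lebesgue_measure ma.
transitivity (nu A); first by rewrite hnu.
apply/esym/lebesgue_measure_unique => // X.
move=> /ocitvP[->|[[x y] /= xy ->]]; first by rewrite !measure0.
rewrite hnu (_ : _ @^-1` _ = `]x - a, y - a]%classic)%R.
  rewrite mu_itv ?ltW//; transitivity ((y - a - (x - a))%:E).
    by congr EFin; ring.
  by apply/esym/mu_itv; rewrite lerD2r ltW.
by apply/seteqP; split => z /=; rewrite !in_itv/= ltrBlDr lerBrDr.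
Qed.

(** A translate of the product measure has the same values on rectangles, and these determine it. *)
Lemma planar_measure_exists :
  exists mu : {sigma_finite_measure set (R * R)%type -> \bar R},
    (forall (a : (R * R)%type) (A : set (R * R)%type), measurable A ->
       mu ((fun x => (x.1 + a.1, x.2 + a.2)%R) @^-1` A) = mu A) /\
    forall a b : R, (a <= b)%R ->
       mu (`]a, b]%classic `*` `]a, b]%classic) = ((b - a) ^+ 2)%:E.
Proof.
have [l [tl hl]] := line_measure_exists.
have [|mu hmu] := bundle_sigma_finite
  (mu := [the {measure set (R * R)%type -> \bar R} of l \x l]).
  have /sigma_finiteP[F [TF ndF Foo]] := sigma_finiteT l.
  exists (fun k => F k `*` F k) => [|k].
    apply/esym/seteqP; split => // -[x y] _.
    have [[i _ Fx] [j _ Fy]] : (\bigcup_k F k) x /\ (\bigcup_k F k) y.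
      by rewrite -TF.
    exists (maxn i j) => //; split.
      by have /subsetPset := ndF _ _ (leq_maxl i j); exact.
    by have /subsetPset := ndF _ _ (leq_maxr i j); exact.
  have [mF oF] := Foo k; split; first exact: measurableX.
  by rewrite [ltLHS]product_measure1E// lte_mul_pinfty// ge0_fin_numE.
exists mu; split.
  move=> [a b] A mA.
  have mab : measurable_fun setT
      (fun x : (R * R)%type => (x.1 + a, x.2 + b)%R).
    by apply: measurable_fun_pair; apply: measurable_funD.
  have [nu hnu] := image_measure
    [the {measure set (R * R)%type -> \bar R} of l \x l] mab.
  rewrite !hmu; transitivity (nu A); first by rewrite hnu.
  apply/esym/product_measure_unique => // X Y mX mY.
  rewrite hnu (_ : _ @^-1` _ = ((fun x => (x + a)%R) @^-1` X) `*`
     ((fun x => (x + b)%R) @^-1` Y))//.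
  have mD (c : R) B : measurable B ->
      measurable ((fun x : R => (x + c)%R) @^-1` B).
    by apply: preimage_measurable; exact: measurable_funD.
  have mX' := mD a _ mX; have mY' := mD b _ mY.
  rewrite -(tl a X mX) -(tl b Y mY); exact: product_measure1E.
move=> a b ab; rewrite hmu [LHS]product_measure1E//.
transitivity ((b - a)%:E * (b - a)%:E); last by rewrite -EFinM expr2.
by congr (_ * _); exact: hl.
Qed.

Variable N : nat.
Implicit Types u v w : vecR R N.

Definition vadd u v : vecR R N :=
  [tuple ((tnth u j).1 + (tnth v j).1, (tnth u j).2 + (tnth v j).2)%R | j < N].

Definition vopp u : vecR R N := [tuple (- (tnth u j).1, - (tnth u j).2)%R | j < N].

Lemma vecP u v :
  (forall j, (tnth u j).1 = (tnth v j).1 /\ (tnth u j).2 = (tnth v j).2) ->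
  u = v.
Proof.
move=> h; apply: eq_from_tnth => j; have [] := h j.
by case: (tnth u j) (tnth v j) => [a b] [c d] /= -> ->.
Qed.

Lemma measurable_re j : measurable_fun setT (fun v => (tnth v j).1).
Proof. exact: (measurableT_comp measurable_fst (measurable_tnth j)). Qed.

Lemma measurable_im j : measurable_fun setT (fun v => (tnth v j).2).
Proof. exact: (measurableT_comp measurable_snd (measurable_tnth j)). Qed.

Lemma measurable_vec d (T : measurableType d) (f : T -> vecR R N) :
  (forall j, measurable_fun setT (fun x => (tnth (f x) j).1)) ->
  (forall j, measurable_fun setT (fun x => (tnth (f x) j).2)) ->
  measurable_fun setT f.
Proof.
move=> h1 h2; apply/measurable_fun_tnthP => j.
rewrite (_ : _ \o _ = fun x => ((tnth (f x) j).1, (tnth (f x) j).2)).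
  exact: measurable_fun_pair.
by apply/funext => x /=; case: (tnth _ _).
Qed.

(** Invariance is checked on boxes, one coordinate at a time. The value on cubes serves to show that
    the unit ball has positive finite mass. *)
Lemma vec_lebesgue_exists :
  exists mu : {sigma_finite_measure set (vecR R N) -> \bar R},
    translation_invariant vadd mu /\
    forall a b : R, (a <= b)%R ->
      mu (box (fun=> `]a, b]%classic `*` `]a, b]%classic)) = ((b - a) ^+ 2 ^+ N)%:E.
Proof.
have [l [tl hl]] := planar_measure_exists.
have [mu hmu] := tuple_measure_exists (fun _ : 'I_N => l).
exists mu; split; last first.
  move=> a b ab; rewrite hmu; last by move=> _; exact: measurableX.
  under eq_bigr do rewrite hl//.
  by rewrite prodEFin prodr_const card_ord.
move=> y A mA.
have my : measurable_fun setT (vadd^~ y).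
  apply: measurable_vec => j.
    under [X in measurable_fun _ X]funext do rewrite tnth_mktuple/=.
    by apply: measurable_funD => //; exact: measurable_re.
  under [X in measurable_fun _ X]funext do rewrite tnth_mktuple/=.
  by apply: measurable_funD => //; exact: measurable_im.
have [nu hnu] := image_measure mu my.
rewrite -hnu; apply: (box_measure_unique (m := fun _ => l)) => // X mX.
rewrite hnu; pose shift j (x : (R * R)%type) :=
  (x.1 + (tnth y j).1, x.2 + (tnth y j).2)%R.
transitivity (mu (box (fun j => shift j @^-1` X j))).
  congr (mu _); apply/seteqP; split => v /= h j; have := h j;
    by rewrite tnth_mktuple.
rewrite hmu; first by apply: eq_bigr => j _; exact: tl.
move=> j; apply: preimage_measurable => //.
by apply: measurable_fun_pair; apply: measurable_funD.
Qed.

End vec_lebesgue.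

(** * The unitary action on vectors *)

Section unitary_action.
Variables (R : realType) (N : nat).
Implicit Types (U : 'M[R[i]]_N) (u v w : vecR R N).

(** Column form of a vector: it turns [act_unitary] into a matrix product, so that identities about
    the action become matrix algebra. *)
Definition vcol v : 'cV[R[i]]_N := \col_j cvec v j.

Lemma vcol_inj : injective vcol.
Proof.
move=> u v uv; apply: vecP => j.
by have := congr1 (fun M : 'cV[R[i]]_N => M j ord0) uv; rewrite !mxE => -[].
Qed.

Lemma cvec_vec_of (z : 'I_N -> R[i]) j : cvec (vec_of z) j = z j.
Proof. by rewrite /cvec tnth_mktuple /=; case: (z j). Qed.

Lemma vcol_act U v : vcol (act_unitary U v) = U *m vcol v.
Proof.
by apply/colP => j; rewrite !mxE cvec_vec_of; apply: eq_bigr => k _; rewrite mxE.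
Qed.

Lemma unitaryP U : unitary U <-> U *m (map_mx conjc U)^T = 1%:M.
Proof.
split=> [h|h a b].
  apply/matrixP => a b; rewrite !mxE -h.
  by apply: eq_bigr => k _; rewrite !mxE.
have := congr1 (fun M : 'M[R[i]]_N => M a b) h; rewrite !mxE => <-.
by apply: eq_bigr => k _; rewrite !mxE.
Qed.

Definition adjoint U := (map_mx conjc U)^T.

Lemma act_unitaryK U : unitary U ->
  cancel (act_unitary U) (act_unitary (adjoint U)).
Proof.
move=> /unitaryP/mulmx1C h v; apply: vcol_inj.
by rewrite !vcol_act mulmxA h mul1mx.
Qed.

Lemma act_unitaryVK U : unitary U ->
  cancel (act_unitary (adjoint U)) (act_unitary U).
Proof.
by move=> /unitaryP h v; apply: vcol_inj; rewrite !vcol_act mulmxA h mul1mx.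
Qed.

Lemma act_unitaryD U : {morph act_unitary U : u v / vadd u v}.
Proof.
have vcolD u v : vcol (vadd u v) = vcol u + vcol v.
  by apply/colP => j; rewrite !mxE /cvec tnth_mktuple.
by move=> u v; apply: vcol_inj; rewrite vcolD !vcol_act vcolD mulmxDr.
Qed.

Definition vscale (c : R) v : vecR R N :=
  [tuple (c * (tnth v j).1, c * (tnth v j).2) | j < N].

Lemma act_unitary_vscale U c v :
  act_unitary U (vscale c v) = vscale c (act_unitary U v).
Proof.
have vcolZ u : vcol (vscale c u) = c%:C%C *: vcol u.
  by apply/colP => j; rewrite !mxE /cvec tnth_mktuple; simpc.
by apply: vcol_inj; rewrite vcolZ !vcol_act vcolZ scalemxAr.
Qed.

Lemma sqnorm_vcol v :
  sqnorm v = complex.Re (((map_mx conjc (vcol v))^T *m vcol v) ord0 ord0).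
Proof.
rewrite !mxE raddf_sum; apply: eq_bigr => j _.
by rewrite !mxE /= mulNr opprK -!expr2.
Qed.

Lemma sqnorm_act_unitary U v : unitary U -> sqnorm (act_unitary U v) = sqnorm v.
Proof.
move=> /unitaryP/mulmx1C h; rewrite !sqnorm_vcol vcol_act map_mxM trmx_mul.
by rewrite mulmxA -(mulmxA _ _ U) h mulmx1.
Qed.

Lemma sqnorm_ge0 v : 0 <= sqnorm v.
Proof. by apply: sumr_ge0 => j _; rewrite addr_ge0// sqr_ge0. Qed.

Lemma sqnorm_vscale c v : sqnorm (vscale c v) = c ^+ 2 * sqnorm v.
Proof.
rewrite /sqnorm mulr_sumr; apply: eq_bigr => j _.
by rewrite tnth_mktuple /= !exprMn mulrDr.
Qed.

Lemma measurable_sqnorm : measurable_fun setT (@sqnorm R N).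
Proof.
apply: measurable_sum => j; apply: measurable_funD; apply: measurable_funX.
  exact: measurable_re.
exact: measurable_im.
Qed.

Lemma measurable_act_unitary U : measurable_fun setT (act_unitary U).
Proof.
have tnth1 j v : (tnth (act_unitary U v) j).1 = \sum_k
    (complex.Re (U j k) * (tnth v k).1 - complex.Im (U j k) * (tnth v k).2).
  by rewrite tnth_mktuple /= raddf_sum; apply: eq_bigr => k _; case: (U j k).
have tnth2 j v : (tnth (act_unitary U v) j).2 = \sum_k
    (complex.Re (U j k) * (tnth v k).2 + complex.Im (U j k) * (tnth v k).1).
  by rewrite tnth_mktuple /= raddf_sum; apply: eq_bigr => k _; case: (U j k).
apply: measurable_vec => j.
  under [X in measurable_fun _ X]funext do rewrite tnth1.
  apply: measurable_sum => k.
  by apply: measurable_funB; apply: measurable_funM => //;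
    [exact: measurable_re|exact: measurable_im].
under [X in measurable_fun _ X]funext do rewrite tnth2.
apply: measurable_sum => k.
by apply: measurable_funD; apply: measurable_funM => //;
  [exact: measurable_im|exact: measurable_re].
Qed.

(** A real matrix acts separately on real and imaginary parts. Facts about orthogonal maps can thus
    be inherited from the unitary case. *)
Lemma act_orthE (O : 'M[R]_N) :
  act_orth O = act_unitary (map_mx (real_complex R) O).
Proof.
apply/funext => v; apply: vecP => j; rewrite !tnth_mktuple/= !raddf_sum.
by split; apply: eq_bigr => k _; rewrite !mxE /= mul0r ?subr0 ?addr0.
Qed.

Lemma unitary_orth (O : 'M[R]_N) :
  orthogonal O -> unitary (map_mx (real_complex R) O).
Proof.
move=> h a b; have := congr1 (real_complex R) (h a b).
rewrite rmorph_nat => <-; rewrite rmorph_sum; apply: eq_bigr => k _.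
by rewrite !mxE rmorphM /= oppr0.
Qed.

End unitary_action.

(** * Invariant laws on spheres *)

Section sphere_laws.
Variables (R : realType) (N : nat).
Hypothesis N0 : (0 < N)%N.
Implicit Types (U : 'M[R[i]]_N) (u v w : vecR R N).

(** The zero vector is sent to itself, because [0^-1 = 0]. *)
Definition normalize v : vecR R N := vscale (Num.sqrt (sqnorm v))^-1 v.

Lemma sqnorm_normalize v : 0 < sqnorm v -> sqnorm (normalize v) = 1.
Proof.
by move=> v0; rewrite sqnorm_vscale exprVn sqr_sqrtr ?mulVf ?gt_eqF// ltW.
Qed.

Lemma measurable_normalize : measurable_fun setT normalize.
Proof.
have h : measurable_fun setT (fun v => (Num.sqrt (sqnorm v))^-1).
  (* Real powers are measurable; both expressions are [0] at norm [0]. *)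
  rewrite (_ : (fun=> _) = fun v => (powR (sqnorm v) (- 2^-1))); last first.
    by apply/funext => v; rewrite powRN powR12_sqrt// sqnorm_ge0.
  apply: (@measurableT_comp _ _ _ _ _ _ (fun x : R => powR x (- 2^-1))) => //.
  exact: measurable_sqnorm.
apply: measurable_vec => j;
  under [X in measurable_fun _ X]funext do rewrite tnth_mktuple/=;
  apply: measurable_funM => //; [exact: measurable_re|exact: measurable_im].
Qed.

(* The law is that of [normalize (pi v)], for [v] Lebesgue-distributed on the
   part of the unit ball where [pi v] does not vanish. *)
Lemma sphere_law_exists (pi : vecR R N -> vecR R N) :
  measurable_fun setT pi ->
  (forall v, (forall j, 0 < (tnth v j).1) -> 0 < sqnorm (pi v)) ->
  exists P : probability (vecR R N) R,
    (forall A, measurable A ->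
      (forall v, 0 < sqnorm (pi v) -> A (normalize (pi v))) -> P A = 1%E) /\
(forall U, unitary U ->
      (forall v, pi (act_unitary U v) = act_unitary U (pi v)) ->
      forall A, measurable A -> P (act_unitary U @^-1` A) = P A).
Proof.
move=> mpi pi0; have [mu [tmu hmu]] := vec_lebesgue_exists R N.
have N1 : (N%:R : R) != 0 by rewrite pnatr_eq0 -lt0n.
have Nge1 : 1 <= (N%:R : R) by rewrite ler1n.
(* On the cube below, each complex coordinate contributes at most [2 * c ^+ 2 <= 2 * c = 1 / N] to
   [sqnorm], so the cube lies in the ball; its real parts are positive, so [pi0] applies to it. *)
pose c : R := (2 * N%:R)^-1.
have c0 : 0 < c by rewrite invr_gt0 mulr_gt0// (lt_le_trans ltr01).
pose small : set (vecR R N) := box (fun=> `]0, c]%classic `*` `]0, c]%classic).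
pose ball := [set v : vecR R N | sqnorm v <= 1].
have small_ball : small `<=` ball.
  move=> v hv; rewrite /ball /= /sqnorm.
  apply: (@le_trans _ _ (\sum_(j < N) (N%:R)^-1)); last first.
    by rewrite sumr_const card_ord -[_ *+ _]mulr_natr mulVf.
  apply: ler_sum => j _; have [] := hv j; rewrite /= !in_itv/=.
  move=> /andP[a0 ac] /andP[b0 bc].
  have c1 : c <= 1.
    by rewrite invf_le1 ?mulr_gt0// ?(lt_le_trans ltr01)//; nra.
  have -> : (N%:R)^-1 = c + c :> R by rewrite /c; field.
  by apply: lerD; nra.
have mball : measurable ball.
  rewrite (_ : ball = @sqnorm R N @^-1` `]-oo, 1]%classic).
    by apply: preimage_measurable => //; exact: measurable_sqnorm.
  by apply/seteqP; split => v; rewrite /= in_itv.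
have msmall : measurable small.
  by apply: measurable_box => j; exact: measurableX.
have small_pos : (0 < mu small)%E.
  by rewrite hmu ?ltW// lte_fin subr0 !exprn_gt0.
(* The interval must contain [-1] while being open on the left, hence the endpoint [-2]. *)
pose big : set (vecR R N) :=
  box (fun=> `](-2 : R), 1]%classic `*` `](-2 : R), 1]%classic).
have ball_fin : (mu ball < +oo)%E.
  have bigfin : (mu big < +oo)%E by rewrite hmu ?ltry//; lra.
  apply: le_lt_trans bigfin; apply: le_measure; rewrite ?inE//.
    by apply: measurable_box => j; exact: measurableX.
  move=> v hv j; have : (tnth v j).1 ^+ 2 + (tnth v j).2 ^+ 2 <= 1.
    apply: le_trans hv; rewrite /sqnorm (bigD1 j)//= lerDl.
    by apply: sumr_ge0 => k _; rewrite addr_ge0// sqr_ge0.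
  by move=> h; split; rewrite /= in_itv/=; nra.
(* Unitary maps are additive bijections preserving the ball, whose mass is positive and finite. *)
have muU U B : unitary U -> measurable B -> mu (act_unitary U @^-1` B) = mu B.
  move=> uU; apply: (@translation_invariant_isometry _ _ _ (@vadd R N)
    (@vopp R N) _ _ _ _ _ mu _ (act_unitary (adjoint U)) ball) => //.
  - by move=> u v; apply: vecP => j; rewrite !tnth_mktuple/=; split; exact: addrC.
  - by move=> u v; apply: vecP => j; rewrite !tnth_mktuple/=; split; ring.
  - by move=> u v; apply: vecP => j; rewrite !tnth_mktuple/=; split; ring.
  - have m1 j : measurable_fun setT
        (fun p : vecR R N * vecR R N => tnth p.1 j).
      exact: (measurableT_comp (measurable_tnth j) measurable_fst).
    have m2 j : measurable_fun setT
        (fun p : vecR R N * vecR R N => tnth p.2 j).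
      exact: (measurableT_comp (measurable_tnth j) measurable_snd).
    apply: measurable_vec => j;
      under [X in measurable_fun _ X]funext do rewrite tnth_mktuple/=;
      apply: measurable_funD.
    + exact: (measurableT_comp measurable_fst (m1 j)).
    + exact: (measurableT_comp measurable_fst (m2 j)).
    + exact: (measurableT_comp measurable_snd (m1 j)).
    + exact: (measurableT_comp measurable_snd (m2 j)).
  - apply: measurable_vec => j;
      under [X in measurable_fun _ X]funext do rewrite tnth_mktuple/=;
      apply: measurableT_comp => //; [exact: measurable_re|exact: measurable_im].
  - exact: measurable_act_unitary.
  - exact: measurable_act_unitary.
  - exact: act_unitaryK.
  - exact: act_unitaryVK.
  - exact: act_unitaryD.
  - by apply/seteqP; split => v; rewrite /ball /= sqnorm_act_unitary.
  - by rewrite ball_fin andbT (lt_le_trans small_pos)// le_measure// inE.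
pose S := ball `&` [set v | 0 < sqnorm (pi v)].
have mS : measurable S.
  apply: measurableI => //.
  rewrite (_ : [set v | _] = (@sqnorm R N \o pi) @^-1` `]0, +oo[%classic).
    apply: preimage_measurable => //.
    by apply: measurableT_comp => //; exact: measurable_sqnorm.
  by apply/seteqP; split => v; rewrite /= in_itv/= andbT.
have S_pos : (0 < mu S)%E.
  rewrite (lt_le_trans small_pos)// le_measure ?inE// => v hv.
  split; first exact: small_ball.
  by apply: pi0 => j; have [] := hv j; rewrite /= in_itv/= => /andP[].
have S_fin : (mu S < +oo)%E.
  by apply: le_lt_trans ball_fin; rewrite le_measure ?inE//; exact: subIsetl.
(* Support of the point mass on which [mnormalize] falls back when the total mass is [0] or
   infinite; [S_pos] and [S_fin] exclude both. *)
pose v0 : vecR R N := [tuple (0, 0) | j < N].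
pose P0 := mnormalize (mrestr mu mS) (@dirac _ _ v0 R).
have P0E A : P0 A = (mu (A `&` S) * (fine (mu S))^-1%:E)%E.
  by rewrite /P0 /mnormalize /= /mrestr setTI gt_eqF// lt_eqF.
have mf : measurable_fun setT (normalize \o pi).
  by apply: measurableT_comp => //; exact: measurable_normalize.
have [P1 hP1] := image_measure [the {measure set (vecR R N) -> \bar R} of P0] mf.
have [|P hP] := bundle_probability (mu := P1).
  by rewrite hP1 preimage_setT; exact: probability_setT.
have PE A : P A = (mu (((normalize \o pi) @^-1` A) `&` S) * (fine (mu S))^-1%:E)%E.
  by rewrite hP hP1 [LHS]P0E.
exists P; split.
  move=> A mA hA; rewrite PE (_ : _ `&` _ = S).
    rewrite -(fineK (x := mu S)) ?ge0_fin_numE// -EFinM /= mulfV// gt_eqF//.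
    by rewrite fine_gt0// S_pos.
  by apply: setIidr => v [_ /= piv]; exact: (hA v piv).
(* [U] commutes with [pi] and with normalization and preserves [S], so the invariance of [mu] passes
   to the law. *)
move=> U uU piU A mA; rewrite !PE; congr (_ * _)%E.
rewrite -[RHS](muU U)//; last first.
  by apply: measurableI => //; exact: (preimage_measurable mf mA).
congr (mu _); apply/seteqP; split => v /=;
  rewrite /S /ball /= piU /normalize !sqnorm_act_unitary// act_unitary_vscale//.
Qed.

End sphere_laws.

(** * The joint law of the inputs *)

Section input_laws.
Variables (R : realType) (N : nat).
Hypothesis N0 : (0 < N)%N.

Lemma measurable_act_orth (O : 'M[R]_N) : measurable_fun setT (act_orth O).
Proof. by rewrite act_orthE; exact: measurable_act_unitary. Qed.

Lemma measurable_unit_sphere :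
  measurable [set v : vecR R N | sqnorm v = 1].
Proof.
by apply: (preimage_measurable (@measurable_sqnorm R N) (measurable_set1 1)).
Qed.

Lemma measurable_real_sphere : measurable (@real_sphere R N).
Proof.
rewrite (_ : @real_sphere R N = [set v | sqnorm v = 1] `&`
  \bigcap_(j in [set: 'I_N]) (fun v => (tnth v j).2) @^-1` [set 0]).
  apply: measurableI; first exact: measurable_unit_sphere.
  apply: fin_bigcap_measurable => [|j _]; first exact: finite_finset.
  exact: (preimage_measurable (measurable_im _) (measurable_set1 0)).
by apply/seteqP; split => v /= [v1 v2]; split => // j; [move=> _|]; exact: v2.
Qed.

Lemma ex_pos_sqnorm (v : vecR R N) :
  (forall j, 0 < (tnth v j).1) -> 0 < sqnorm v.
Proof.
move=> h; rewrite /sqnorm (bigD1 (Ordinal N0))//= ltr_pwDl//.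
  by rewrite ltr_pwDl ?exprn_gt0 ?sqr_ge0.
by apply: sumr_ge0 => k _; rewrite addr_ge0// sqr_ge0.
Qed.

Lemma uniform_complex_sphere_exists :
  exists P : probability (vecR R N) R,
    uniform_complex_sphere (P : set (vecR R N) -> \bar R).
Proof.
have [] := sphere_law_exists N0 (@measurable_id _ _ setT) ex_pos_sqnorm.
move=> P [hP1 hP2]; exists P; split.
  apply: hP1; first exact: measurable_unit_sphere.
  by move=> v v0; exact: sqnorm_normalize.
by move=> U uU A mA; exact: hP2.
Qed.

Lemma uniform_real_sphere_exists :
  exists P : probability (vecR R N) R,
    uniform_real_sphere (P : set (vecR R N) -> \bar R).
Proof.
(* Dropping imaginary parts commutes with real matrices, so the law obtained is orthogonally
   invariant. *)
pose re (v : vecR R N) : vecR R N := [tuple ((tnth v j).1, 0) | j < N].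
have [||P [hP1 hP2]] := @sphere_law_exists R N N0 re.
- apply: measurable_vec => j.
    under [X in measurable_fun _ X]funext do rewrite tnth_mktuple/=.
    exact: measurable_re.
  under [X in measurable_fun _ X]funext do rewrite tnth_mktuple/=.
  exact: measurable_cst.
- by move=> v h; apply: ex_pos_sqnorm => j; rewrite tnth_mktuple/=; exact: h.
exists P; split.
  apply: hP1; first exact: measurable_real_sphere.
  move=> v v0; split; first exact: sqnorm_normalize.
  by move=> j; rewrite !tnth_mktuple/= mulr0.
move=> O oO A mA; rewrite act_orthE; apply: hP2 => //; first exact: unitary_orth.
move=> v; rewrite -act_orthE; apply: vecP => j; rewrite !tnth_mktuple/=; split.
  by apply: eq_bigr => k _; rewrite tnth_mktuple.
by rewrite big1// => k _; rewrite tnth_mktuple mulr0.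
Qed.

Variable C : nat.

(** Each input gets its own matrix, so that one coordinate of one input can change sign alone. *)
Definition act_inputs (O : 'I_C -> 'M[R]_N) (x : inputs R C N) : inputs R C N :=
  [tuple act_orth (O i) (tnth x i) | i < C].

Lemma measurable_act_inputs O : measurable_fun setT (act_inputs O).
Proof.
apply/measurable_fun_tnthP => i.
rewrite (_ : _ \o _ = act_orth (O i) \o (@tnth _ _)^~ i).
  by apply: measurableT_comp;
    [exact: measurable_act_orth|exact: measurable_tnth].
by apply/funext => x /=; rewrite tnth_mktuple.
Qed.

Definition unit_inputs : set (inputs R C N) :=
  box (fun=> [set v | sqnorm v = 1]).

Lemma measurable_unit_inputs : measurable unit_inputs.
Proof. by apply: measurable_box => i; exact: measurable_unit_sphere. Qed.

(** The success assumption concerns every law of the problem, so one must be exhibited: the product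
    of the sphere laws. Its joint invariance reduces to boxes, where each factor is invariant under
    its own matrix. *)
Lemma rvs_distribution_exists (kstar : 'I_C) :
  exists P : probability (inputs R C N) R,
    [/\ rvs_distribution kstar P,
        P unit_inputs = 1%E &
        forall O, (forall i, orthogonal (O i)) ->
          forall X, measurable X -> P (act_inputs O @^-1` X) = P X].
Proof.
have [Pc [Pc1 Pc2]] := uniform_complex_sphere_exists.
have [Pr [Pr1 Pr2]] := uniform_real_sphere_exists.
pose nu (i : 'I_C) := if i == kstar then Pr else Pc.
have nu1 i : nu i [set v | sqnorm v = 1] = 1%E.
  rewrite /nu; case: eqP => // _; apply/eqP; rewrite eq_le probability_le1//=.
    rewrite -Pr1; apply: le_measure; rewrite ?inE//.
    - exact: measurable_real_sphere.
    - exact: measurable_unit_sphere.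
    - by move=> v [].
  exact: measurable_unit_sphere.
have nuO i O A : orthogonal O -> measurable A -> nu i (act_orth O @^-1` A) = nu i A.
  move=> oO mA; rewrite /nu; case: eqP => // _; first exact: Pr2.
  by rewrite act_orthE; apply: Pc2 => //; exact: unitary_orth.
have [mu hmu] := tuple_measure_exists (fun i => nu i).
have [|P hP] := bundle_probability (mu := mu).
  rewrite (_ : setT = box (fun=> setT)); last by apply/seteqP; split.
  apply: etrans (hmu (fun=> setT) _) _ => //.
  by rewrite big1// => i _; exact: probability_setT.
have PE A : (forall i, measurable (A i)) -> P (box A) = (\prod_(i < C) nu i (A i))%E.
  by move=> mA; rewrite hP; exact: hmu.
have PiE i A : measurable A -> P [set x | A (tnth x i)] = nu i A.
  move=> mA; rewrite (_ : [set x | _] = box (fun j => if j == i then A else setT)).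
    rewrite PE; last by move=> j; case: ifP.
    by rewrite (bigD1 i)//= eqxx big1 ?mule1// => j /negbTE ->; exact: probability_setT.
  apply/seteqP; split => x /= h; first by move=> j; case: eqP => // ->.
  by have := h i; rewrite eqxx.
exists P; split.
- split.
    move=> A mA; rewrite [X in P X](_ : _ = box A)// PE//.
    rewrite (eq_bigr (fun i => (fine (nu i (A i)))%:E)); last first.
      by move=> i _; rewrite fineK// fin_num_measure.
    by rewrite prodEFin; apply: eq_bigr => i _; rewrite -PiE.
  move=> i; case: eqP => [->|/eqP ik].
    split; first by rewrite /marginal [LHS]PiE /nu ?eqxx//;
      exact: measurable_real_sphere.
    move=> O oO A mA; rewrite /marginal [LHS]PiE ?[RHS]PiE /nu ?eqxx//.
      exact: Pr2.
    by apply: preimage_measurable => //; exact: measurable_act_orth.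
  split.
    by rewrite /marginal [LHS]PiE /nu ?(negbTE ik)//; exact: measurable_unit_sphere.
  move=> U uU A mA; rewrite /marginal [LHS]PiE ?[RHS]PiE /nu ?(negbTE ik)//.
    exact: Pc2.
  by apply: preimage_measurable => //; exact: measurable_act_unitary.
- rewrite PE; last by move=> i; exact: measurable_unit_sphere.
  by rewrite big1.
- move=> O oO X mX.
  have [P' hP'] := image_measure P
    (measurable_act_inputs O).
  transitivity (P' X); first by rewrite hP'.
  apply: (@box_measure_unique _ (vecR R N) R C (fun i => nu i)) => // A mA.
  rewrite hP'; transitivity (P (box (fun i => act_orth (O i) @^-1` A i))).
    congr (P _); apply/seteqP; split => x /= h i; have := h i;
      by rewrite tnth_mktuple.
  rewrite PE; first by apply: eq_bigr => i _; exact: nuO.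
  by move=> i; apply: preimage_measurable => //; exact: measurable_act_orth.
Qed.

End input_laws.

(** * Expectations of functions bounded on a set of full measure *)

Section expectation.
Context d (T : measurableType d) (R : realType) (P : probability T R).
Variables (S : set T) (mS : measurable S) (PS : P S = 1%E).
Implicit Types h g : T -> R.

(** The bound is asked on [S] only: polynomials in the coordinates are bounded on unit spheres but
    not on the whole space. *)
Definition bounded_measurable h :=
  measurable_fun setT h /\ exists M, forall x, S x -> `|h x| <= M.

Definition expect h : R := (\int[P]_(x in S) h x)%R.

Lemma bounded_measurable_integrable h : bounded_measurable h ->
  P.-integrable S (EFin \o h).
Proof.
move=> [mh [M hM]]; apply: measurable_bounded_integrable => //.
- by rewrite (le_lt_trans (probability_le1 _ _))// ltry.
- exact: measurable_funS mh.
- exists M; split; first exact: num_real.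
  by move=> y My x Sx; rewrite /= (le_trans (hM x Sx))// ltW.
Qed.

Lemma bounded_measurable_cst (c : R) : bounded_measurable (cst c).
Proof. by split; [exact: measurable_cst|exists `|c|]. Qed.

Lemma bounded_measurableD h g : bounded_measurable h -> bounded_measurable g ->
  bounded_measurable (fun x => h x + g x).
Proof.
move=> [mh [M hM]] [mg [K gK]]; split; first exact: measurable_funD.
exists (M + K) => x Sx; apply: le_trans (ler_normD _ _) _.
by rewrite lerD ?hM ?gK.
Qed.

Lemma bounded_measurableM h g : bounded_measurable h -> bounded_measurable g ->
  bounded_measurable (fun x => h x * g x).
Proof.
move=> [mh [M hM]] [mg [K gK]]; split; first exact: measurable_funM.
by exists (M * K) => x Sx; rewrite normrM ler_pM ?hM ?gK.
Qed.

Lemma bounded_measurableN h : bounded_measurable h ->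
  bounded_measurable (fun x => - h x).
Proof.
move=> [mh [M hM]]; split; first exact: measurableT_comp.
by exists M => x Sx; rewrite normrN hM.
Qed.

Lemma bounded_measurable_sum (I : Type) (s : seq I) (Q : pred I) (h : I -> T -> R) :
  (forall i, bounded_measurable (h i)) ->
  bounded_measurable (fun x => \sum_(i <- s | Q i) h i x).
Proof.
move=> gh; elim: s => [|i s IH].
  under [X in bounded_measurable X]funext do rewrite big_nil.
  exact: bounded_measurable_cst.
under [X in bounded_measurable X]funext do rewrite big_cons.
by case: (Q i) => //; exact: bounded_measurableD.
Qed.

Lemma expect_cst (c : R) : expect (cst c) = c.
Proof. by rewrite /expect Rintegral_cst// [fine _](congr1 fine PS) mulr1. Qed.

Lemma expectD h g : bounded_measurable h -> bounded_measurable g ->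
  expect (fun x => h x + g x) = expect h + expect g.
Proof.
by move=> gh gg; rewrite /expect RintegralD//; exact: bounded_measurable_integrable.
Qed.

Lemma expectZ (c : R) h : bounded_measurable h ->
  expect (fun x => c * h x) = c * expect h.
Proof.
by move=> gh; rewrite /expect RintegralZl//; exact: bounded_measurable_integrable.
Qed.

Lemma expect_sum (I : Type) (s : seq I) (Q : pred I) (h : I -> T -> R) :
  (forall i, bounded_measurable (h i)) ->
  expect (fun x => \sum_(i <- s | Q i) h i x) =
  \sum_(i <- s | Q i) expect (h i).
Proof.
move=> gh; elim: s => [|i s IH].
  under [X in expect X]funext do rewrite big_nil.
  by rewrite big_nil; exact: expect_cst.
under [X in expect X]funext do rewrite big_cons.
rewrite big_cons -IH; case: (Q i) => //.
by rewrite expectD//; exact: bounded_measurable_sum.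
Qed.

Lemma le_expect h g : bounded_measurable h -> bounded_measurable g ->
  (forall x, S x -> h x <= g x) -> expect h <= expect g.
Proof.
by move=> gh gg hg; apply: le_Rintegral => //; exact: bounded_measurable_integrable.
Qed.

Lemma eq_expect h g : (forall x, S x -> h x = g x) -> expect h = expect g.
Proof. by move=> hg; apply: eq_Rintegral => x; rewrite inE => /hg. Qed.

Lemma expect_invariant (f : T -> T) h : measurable_fun setT f ->
  (forall A, measurable A -> P (f @^-1` A) = P A) -> f @^-1` S = S ->
  bounded_measurable h -> expect (h \o f) = expect h.
Proof.
move=> mf Pf fS gh; rewrite /expect /Rintegral; congr fine.
pose P' := measure_function_pushforward__canonical__measure_function_Measure P mf.
transitivity (\int[P']_(x in S) (h x)%:E)%E; last first.
  by apply: eq_measure_integral => A mA _; exact: Pf.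
rewrite -[in LHS]fS; apply/esym/integral_pushforward => //.
  by apply/measurable_EFinP; case: gh.
rewrite fS; apply: (@bounded_measurable_integrable (h \o f)).
case: gh => mh [M hM]; split; first exact: measurableT_comp.
by exists M => x; rewrite -{1}fS; exact: hM.
Qed.

(** Off [S] the function may be unbounded, but that complement is a null set. This links
    [outcome_prob], an integral over the whole space, to [expect]. *)
Lemma integral_expect h : bounded_measurable h ->
  (\int[P]_x (h x)%:E)%E = (expect h)%:E.
Proof.
move=> gh; rewrite /expect /Rintegral fineK; last first.
  exact/integrable_fin_num/bounded_measurable_integrable.
have [mh _] := gh.
rewrite [RHS]integral_mkcond; apply: ae_eq_integral => //.
- exact/measurable_EFinP.
- apply/(measurable_restrictT _ mS)/measurable_funTS; exact/measurable_EFinP.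
- exists (~` S); split; first exact: measurableC.
    apply: etrans (probability_setC P mS) _.
    by apply: etrans (congr1 (fun z => 1 - z)%E PS) _; rewrite subee.
  by move=> x; apply: contra_not => Sx _ /=; rewrite patchE mem_set.
Qed.

End expectation.

(** * Squared moduli of complex numbers *)

Section squared_modulus.
Variable R : realType.
Implicit Types z : R[i].

Definition sqmod z : R := complex.Re z ^+ 2 + complex.Im z ^+ 2.

Lemma sqmod_ge0 z : 0 <= sqmod z.
Proof. by rewrite addr_ge0// sqr_ge0. Qed.

Lemma sqmodM z1 z2 : sqmod (z1 * z2) = sqmod z1 * sqmod z2.
Proof. by case: z1 z2 => [a b] [c d]; rewrite /sqmod /=; ring. Qed.

Lemma sqmod1 : sqmod 1 = 1.
Proof. by rewrite /sqmod /= expr1n expr0n addr0. Qed.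

Lemma sqmod_prod (I : Type) (s : seq I) (Q : pred I) (F : I -> R[i]) :
  sqmod (\prod_(i <- s | Q i) F i) = \prod_(i <- s | Q i) sqmod (F i).
Proof. by apply: big_morph; [exact: sqmodM|exact: sqmod1]. Qed.

Lemma Re_conj_mul z m : complex.Re (conjc z * m * z) = complex.Re m * sqmod z.
Proof. by case: z m => [a b] [c d]; rewrite /sqmod /=; ring. Qed.

End squared_modulus.

(** * Mixing two coordinates by a reflection *)

Section mix.
Variables (R : realType) (N : nat).

(* The reflection [e_j |-> (e_j + e_k) / sqrt 2, e_k |-> (e_j - e_k) / sqrt 2],
   written so that each row is a combination of three basis vectors. *)
Definition mix (j k : 'I_N) : 'M[R]_N :=
  let r := (Num.sqrt 2)^-1 in
  \matrix_(a, b) (((a == j) || (a == k))%:R * r * (b == j)%:R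
    + ((a == j)%:R - (a == k)%:R) * r * (b == k)%:R
    + (~~ ((a == j) || (a == k)))%:R * (b == a)%:R).

Lemma mix_sum j k a (f : 'I_N -> R) : \sum_b mix j k a b * f b =
  ((a == j) || (a == k))%:R * (Num.sqrt 2)^-1 * f j
    + ((a == j)%:R - (a == k)%:R) * (Num.sqrt 2)^-1 * f k
    + (~~ ((a == j) || (a == k)))%:R * f a.
Proof.
have delta c (l : 'I_N) : \sum_b c * (b == l)%:R * f b = c * f l.
  rewrite (bigD1 l)//= eqxx mulr1 big1 ?addr0// => b /negbTE ->.
  by rewrite mulr0 mul0r.
under eq_bigr do rewrite mxE mulrDl mulrDl.
by rewrite !big_split/= !delta.
Qed.

Lemma sqrt2V_sqr : (Num.sqrt 2)^-1 ^+ 2 = 2^-1 :> R.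
Proof. by rewrite exprVn sqr_sqrtr ?ler0n. Qed.

Lemma mix_orthogonal j k : j != k -> orthogonal (mix j k).
Proof.
move=> jk a b; rewrite mix_sum !mxE !eqxx (eq_sym k j) (negbTE jk).
have := sqrt2V_sqr; set r := (Num.sqrt 2)^-1 => rr.
have kj : (k == j) = false by rewrite eq_sym (negbTE jk).
have [->|/negbTE aj] := eqVneq a j; have [->|/negbTE bj] := eqVneq b j;
  rewrite ?eqxx ?bj ?aj ?(negbTE jk) ?kj /=.
- by lra.
- by have [e|e] := eqVneq b k; rewrite ?e ?(negbTE jk) ?kj ?eqxx /=; lra.
- by have [e|e] := eqVneq a k; rewrite ?e ?(negbTE jk) ?kj ?eqxx /=; lra.
have [e|e] := eqVneq a k; have [e'|e'] := eqVneq b k;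
  rewrite ?e ?e' ?eqxx ?(eq_sym k) ?(negbTE e) ?(negbTE e') ?(eq_sym b a) /=; lra.
Qed.

(** With [u], [w] the entries of [z] at [j], [k], the right side is [|u^2 - w^2|^2] and the left
    side is [(|u|^2 - |w|^2)^2]. They differ by four times the square of the imaginary part of
    [u * conj w]. *)
Lemma weight_mix (z : vecR R N) j k : j != k ->
  sqmod (cvec z j) ^+ 2 + sqmod (cvec z k) ^+ 2
    - 2 * (sqmod (cvec z j) * sqmod (cvec z k)) <=
  4 * (sqmod (cvec (act_orth (mix j k) z) j) *
       sqmod (cvec (act_orth (mix j k) z) k)).
Proof.
move=> /negbTE jk; rewrite /sqmod /cvec !tnth_mktuple/= !mix_sum !eqxx.
rewrite (eq_sym k j) jk /= !mul0r !addr0 subr0 sub0r mulN1r !mul1r !mulNr.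
rewrite -!mulrBr -!mulrDr !exprMn sqrt2V_sqr.
move: (tnth z j) (tnth z k) => [a b] [c d] /=.
rewrite -subr_ge0 (_ : _ - _ = 4 * (b * c - a * d) ^+ 2); last by field.
by rewrite mulr_ge0// sqr_ge0.
Qed.

End mix.

(** * Amplitudes of the joint state: collisions, signs, permutations *)

Section joint_states.
Variables (R : realType) (C N T : nat) (own : 'I_T -> 'I_C).
Implicit Types (x : inputs R C N) (a b : basis N T).

Definition weight x i j : R := sqmod (cvec (tnth x i) j).

Lemma sum_weight x i : \sum_j weight x i j = sqnorm (tnth x i).
Proof. by []. Qed.

Lemma sqmod_joint_state x a :
  sqmod (joint_state own x a) = \prod_t weight x (own t) (a t).
Proof. exact: sqmod_prod. Qed.

Lemma sum_sqmod_joint_state x : unit_inputs x ->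
  \sum_a sqmod (joint_state own x a) = 1.
Proof.
move=> ux; under eq_bigr do rewrite sqmod_joint_state.
rewrite -(bigA_distr_bigA (fun t j => weight x (own t) j)).
by apply: big1 => t _; rewrite sum_weight ux.
Qed.

(** Once the common value [j] of [a s] and [a t] is fixed, the sum over [a] factors over the copies,
    and every copy other than [s] and [t] contributes a squared norm [1]. *)
Lemma sum_collision x (s t : 'I_T) : unit_inputs x -> s != t ->
  \sum_(a : basis N T | a s == a t) sqmod (joint_state own x a) =
  \sum_j weight x (own s) j * weight x (own t) j.
Proof.
move=> ux st.
(* The indicator puts the constraint [a s = a t = j] inside the factors, so that the product
   distributes over the sum on all [a]. *)
pose F j (u : 'I_T) k : R :=
  weight x (own u) k * (((u == s) || (u == t)) ==> (k == j))%:R.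
transitivity (\sum_j \prod_u \sum_k F j u k).
  rewrite big_mkcond/= (eq_bigr (fun a : basis N T =>
    \sum_j \prod_u F j u (a u))) => [|a _].
    by rewrite exchange_big/=; apply: eq_bigr => j _; rewrite bigA_distr_bigA.
  rewrite sqmod_joint_state.
  rewrite [RHS](eq_bigr (fun j => (\prod_u weight x (own u) (a u)) *
    \prod_u (((u == s) || (u == t)) ==> (a u == j))%:R)); last first.
    by move=> j _; rewrite -big_split.
  have hj j : \prod_u (((u == s) || (u == t)) ==> (a u == j))%:R =
      ((a s == j) && (a t == j))%:R :> R.
    rewrite (bigD1 s)//= eqxx (bigD1 t) 1?eq_sym//= eqxx orbT /=.
    rewrite big1 ?mulr1 ?natrM ?mulnb -?natrM ?mulnb//.
    by move=> u /andP[us ut]; rewrite (negbTE us) (negbTE ut).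
  under [in RHS]eq_bigr do rewrite hj.
  rewrite -mulr_sumr (_ : \sum_j _ = (a s == a t)%:R); last first.
    rewrite (bigD1 (a s))//= eqxx (eq_sym (a t)) big1 ?addr0// => j.
    by rewrite eq_sym => /negbTE ->.
  by case: (a s == a t); rewrite ?mulr1 ?mulr0.
apply: eq_bigr => j _; rewrite (bigD1 s)//= (bigD1 t) 1?eq_sym//=.
have Fst u : (u == s) || (u == t) -> \sum_k F j u k = weight x (own u) j.
  move=> h; rewrite (bigD1 j)//= /F h eqxx mulr1 big1 ?addr0// => k /negbTE ->.
  by rewrite mulr0.
rewrite !Fst ?eqxx ?orbT// big1 ?mulr1// => u /andP[us ut].
rewrite (eq_bigr (weight x (own u))) ?sum_weight ?ux// => k _.
by rewrite /F (negbTE us) (negbTE ut) mulr1.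
Qed.

Definition used a : {set 'I_C * 'I_N} := [set (own t, a t) | t : 'I_T].

(** When [a] is injective the pairs [(own t, a t)] are distinct, so no factor is repeated and a
    plain set records the whole product. *)
Lemma joint_state_used x a : injectiveb a ->
  joint_state own x a = \prod_(p in used a) cvec (tnth x p.1) p.2.
Proof.
by move=> /injectiveP ia; rewrite big_imset//= => t u _ _ [_ /ia].
Qed.

Lemma card_used a : injectiveb a -> #|used a| = T.
Proof.
move=> /injectiveP ia; rewrite card_imset ?card_ord// => t u [_ /ia]//.
Qed.

Definition flip i0 j0 : 'I_C -> 'M[R]_N :=
  fun i => \matrix_(j, k) ((-1) ^+ ((i == i0) && (j == j0)) * (j == k)%:R).

Lemma flip_orthogonal i0 j0 i : orthogonal (flip i0 j0 i).
Proof.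
move=> j k; rewrite (bigD1 j)//= !mxE eqxx mulr1 big1 => [|l /negbTE lj].
  have [->|kj] := eqVneq k j; last first.
    by rewrite !mulr0 addr0.
  by rewrite mulr1 addr0 -expr2 sqrr_sign.
by rewrite !mxE (eq_sym j l) lj mulr0 mul0r.
Qed.

Lemma cvec_flip i0 j0 x i j :
  cvec (tnth (act_inputs (flip i0 j0) x) i) j =
  (-1) ^+ ((i == i0) && (j == j0)) * cvec (tnth x i) j.
Proof.
rewrite /cvec !tnth_mktuple/= (bigD1 j)//= big1 => [|k /negbTE kj]; last first.
  by rewrite !mxE (eq_sym j k) kj mulr0 mul0r.
rewrite (bigD1 j)//= big1 => [|k /negbTE kj]; last first.
  by rewrite !mxE (eq_sym j k) kj mulr0 mul0r.
rewrite !mxE eqxx mulr1 !addr0.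
by case: (_ && _); rewrite ?expr1 ?expr0 ?mulN1r ?mul1r.
Qed.

(** The flipped coordinate occurs in the product at most once, hence a single sign. *)
Lemma joint_state_flip i0 j0 x a : injectiveb a ->
  joint_state own (act_inputs (flip i0 j0) x) a =
  (-1) ^+ ((i0, j0) \in used a) * joint_state own x a.
Proof.
move=> ia; rewrite !joint_state_used//.
under eq_bigr do rewrite cvec_flip.
rewrite big_split/=; congr (_ * _).
have [p0|p0] := boolP ((i0, j0) \in used a).
  rewrite (bigD1 (i0, j0))//= !eqxx big1 ?mulr1// => -[i j] /andP[_ /negbTE].
  by rewrite xpair_eqE /= => ->.
rewrite big1// => -[i j] ij; case: (boolP (_ && _)) => //= /andP[/eqP e1 /eqP e2].
by move: p0; rewrite -e1 -e2 ij.
Qed.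

Definition permute (s : {perm 'I_N}) : 'I_C -> 'M[R]_N :=
  fun=> \matrix_(j, k) (s j == k)%:R.

Lemma permute_orthogonal s i : orthogonal (permute s i).
Proof.
move=> j k; rewrite (bigD1 (s j))//= !mxE eqxx mul1r big1 => [|l /negbTE lj].
  by rewrite addr0 (inj_eq perm_inj) eq_sym.
by rewrite !mxE (eq_sym (s j) l) lj mul0r.
Qed.

Lemma cvec_permute s x i j :
  cvec (tnth (act_inputs (permute s) x) i) j = cvec (tnth x i) (s j).
Proof.
rewrite /cvec !tnth_mktuple/= (bigD1 (s j))//= big1 => [|k /negbTE kj]; last first.
  by rewrite !mxE (eq_sym (s j) k) kj mul0r.
rewrite (bigD1 (s j))//= big1 => [|k /negbTE kj]; last first.
  by rewrite !mxE (eq_sym (s j) k) kj mul0r.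
by rewrite !mxE eqxx !mul1r !addr0.
Qed.

(** List the values of [f] and then all other indices, and do the same for [g]. Matching the two
    enumerations position by position is the permutation. *)
Lemma perm_extends (f g : 'I_T -> 'I_N) : injective f -> injective g ->
  exists s : {perm 'I_N}, forall t, s (f t) = g t.
Proof.
move=> fi gi.
pose l (h : 'I_T -> 'I_N) := codom h ++ enum [predC codom h].
have ul h : injective h -> uniq (l h).
  move=> hi; rewrite cat_uniq enum_uniq andbT map_inj_uniq ?enum_uniq//=.
  by apply/hasPn => j; rewrite mem_enum.
have ml h j : j \in l h by rewrite mem_cat mem_enum inE orbN.
have sl h : injective h -> size (l h) = N.
  move=> hi; rewrite -[RHS]card_ord -(card_uniqP (ul h hi)).
  by apply: eq_card => j; rewrite ml.
have hs j : (index j (l f) < size (l g))%N.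
  rewrite (sl g gi); apply: (@leq_trans (size (l f)));
  by rewrite ?index_mem ?(sl f fi).
pose s0 j := nth j (l g) (index j (l f)).
have s0i : injective s0.
  move=> j k; rewrite /s0 (set_nth_default k)// => /eqP.
  by rewrite nth_uniq ?ul// => /eqP/index_inj; apply.
exists (perm s0i) => t; rewrite permE /s0.
have ft : f t = nth (f t) (l f) t.
  rewrite nth_cat size_codom card_ord ltn_ord (nth_map t) ?size_enum_ord//.
  by rewrite nth_ord_enum.
rewrite {2}ft index_uniq ?ul//; last by rewrite size_cat size_codom card_ord ltn_addr.
rewrite nth_cat size_codom card_ord ltn_ord (nth_map t) ?size_enum_ord//.
by rewrite nth_ord_enum.
Qed.

Lemma joint_state_permute a b : injectiveb a -> injectiveb b ->
  exists s, forall x, joint_state own (act_inputs (permute s) x) a =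
                      joint_state own x b.
Proof.
move=> /injectiveP ia /injectiveP ib; have [s hs] := perm_extends ia ib.
by exists s => x; apply: eq_bigr => t _; rewrite cvec_permute hs.
Qed.

End joint_states.

(** * Moments of the joint state under an orthogonally invariant law *)

Section joint_state_expectations.
Variables (R : realType) (C N T : nat) (own : 'I_T -> 'I_C).
Variable P : probability (inputs R C N) R.
Hypothesis N0 : (0 < N)%N.
Hypothesis P1 : P (@unit_inputs R N C) = 1%E.
Hypothesis Pinv : forall O : 'I_C -> 'M[R]_N, (forall i, orthogonal (O i)) ->
  forall X, measurable X -> P (act_inputs O @^-1` X) = P X.
Implicit Types (x : inputs R C N) (a b : basis N T).

Let S : set (inputs R C N) := @unit_inputs R N C.
Let mS : measurable S. Proof. exact: measurable_unit_inputs. Qed.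
Local Notation E := (expect P S).
Local Notation bm := (bounded_measurable (R := R) S).

Let act_unit O : (forall i, orthogonal (O i)) -> act_inputs O @^-1` S = S.
Proof.
move=> oO; apply/seteqP; split => x hx i; have := hx i;
  rewrite /= tnth_mktuple act_orthE sqnorm_act_unitary//; exact: unitary_orth.
Qed.

Lemma bounded_measurable_act O h : (forall i, orthogonal (O i)) -> bm h ->
  bm (h \o act_inputs O).
Proof.
move=> oO [mh [M hM]]; split.
  by apply: measurableT_comp => //; exact: measurable_act_inputs.
by exists M => x Sx; apply: hM; move: Sx; rewrite -{1}(act_unit oO).
Qed.

Lemma expect_act_inputs O h : (forall i, orthogonal (O i)) -> bm h ->
  E (h \o act_inputs O) = E h.
Proof.
move=> oO bh; apply: expect_invariant => //; last exact: act_unit.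
- exact: measurable_act_inputs.
- by move=> A mA; exact: Pinv.
Qed.

Lemma bounded_measurable_re i j : bm (fun x => (tnth (tnth x i) j).1).
Proof.
split.
  exact: (measurableT_comp (measurable_re j) (measurable_tnth i)).
exists 1 => x ux; rewrite -(@expr_le1 _ 2)// -normrX ger0_norm ?sqr_ge0//.
rewrite -(ux i) /sqnorm (bigD1 j)//= -addrA lerDl addr_ge0 ?sqr_ge0//.
by apply: sumr_ge0 => k _; rewrite addr_ge0// sqr_ge0.
Qed.

Lemma bounded_measurable_im i j : bm (fun x => (tnth (tnth x i) j).2).
Proof.
split.
  exact: (measurableT_comp (measurable_im j) (measurable_tnth i)).
exists 1 => x ux; rewrite -(@expr_le1 _ 2)// -normrX ger0_norm ?sqr_ge0//.
rewrite -(ux i) /sqnorm (bigD1 j)//= addrAC addrC lerDl addr_ge0 ?sqr_ge0//.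
by apply: sumr_ge0 => k _; rewrite addr_ge0// sqr_ge0.
Qed.

Definition cbounded_measurable (F : inputs R C N -> R[i]) :=
  bm (fun x => complex.Re (F x)) /\ bm (fun x => complex.Im (F x)).

Lemma cbounded_measurable_cst (z : R[i]) : cbounded_measurable (cst z).
Proof. by split; exact: bounded_measurable_cst. Qed.

Lemma cbounded_measurableM F G :
  cbounded_measurable F -> cbounded_measurable G ->
  cbounded_measurable (fun x => F x * G x).
Proof.
move=> [F1 F2] [G1 G2]; split.
  rewrite (_ : (fun x => _) = fun x => complex.Re (F x) * complex.Re (G x)
      + - (complex.Im (F x) * complex.Im (G x))).
    by apply: bounded_measurableD; last apply: bounded_measurableN;
      apply: bounded_measurableM.
  by apply/funext => x; case: (F x) (G x) => [? ?] [? ?].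
rewrite (_ : (fun x => _) = fun x => complex.Re (F x) * complex.Im (G x)
    + complex.Im (F x) * complex.Re (G x)).
  by apply: bounded_measurableD; apply: bounded_measurableM.
by apply/funext => x; case: (F x) (G x) => [? ?] [? ?].
Qed.

Lemma cbounded_measurable_conj F : cbounded_measurable F ->
  cbounded_measurable (fun x => conjc (F x)).
Proof.
move=> [F1 F2]; split.
  rewrite (_ : (fun x => _) = fun x => complex.Re (F x))//.
  by apply/funext => x; case: (F x).
rewrite (_ : (fun x => _) = fun x => - complex.Im (F x)).
  exact: bounded_measurableN.
by apply/funext => x; case: (F x).
Qed.

Lemma cbounded_measurable_prod (I : Type) (s : seq I) (F : I -> _ -> R[i]) :
  (forall i, cbounded_measurable (F i)) ->
  cbounded_measurable (fun x => \prod_(i <- s) F i x).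
Proof.
move=> hF; elim: s => [|i s IH].
  under [X in cbounded_measurable X]funext do rewrite big_nil.
  exact: cbounded_measurable_cst.
under [X in cbounded_measurable X]funext do rewrite big_cons.
exact: cbounded_measurableM.
Qed.

Lemma cbounded_measurable_joint_state a :
  cbounded_measurable (fun x => joint_state own x a).
Proof.
apply: cbounded_measurable_prod => t; split.
  exact: bounded_measurable_re.
exact: bounded_measurable_im.
Qed.

Lemma bounded_measurable_sqmod F : cbounded_measurable F ->
  bm (fun x => sqmod (F x)).
Proof.
by move=> [F1 F2]; apply: bounded_measurableD; apply: bounded_measurableM.
Qed.

Lemma bounded_measurable_weight i j : bm (fun x => weight x i j).
Proof.
apply: bounded_measurable_sqmod; split.
  exact: bounded_measurable_re.
exact: bounded_measurable_im.
Qed.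

Let bw i j := bounded_measurable_weight i j.
Let bww i j k l : bm (fun x => weight x i j * weight x k l).
Proof. by apply: bounded_measurableM; exact: bw. Qed.

Let E0 h : bm h -> (forall x, S x -> 0 <= h x) -> 0 <= E h.
Proof.
move=> bh h0; rewrite -(expect_cst mS P1 0); apply: le_expect => //.
exact: bounded_measurable_cst.
Qed.

Let bZ (c : R) h : bm h -> bm (fun x => c * h x).
Proof. by move=> bh; apply: bounded_measurableM bh; exact: bounded_measurable_cst. Qed.

(** Averaging [weight_mix] and removing the reflection by invariance leaves [4 + 2 = 6] times the
    mixed moment. For [j = k] the bound only says that the moment is nonnegative. *)
Lemma expect_weight_le i j k :
  E (fun x => weight x i j * weight x i j) +
  E (fun x => weight x i k * weight x i k) <=
  6 * E (fun x => weight x i j * weight x i k).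
Proof.
have e0 : 0 <= E (fun x => weight x i j * weight x i k).
  by apply: E0 => // x _; rewrite mulr_ge0// sqmod_ge0.
have [jk|jk] := eqVneq j k; first by move: e0; rewrite jk; lra.
have bh : bm (fun x => 4 * (weight x i j * weight x i k)) by exact: bZ.
have oO (l : 'I_C) : orthogonal (mix R j k) by exact: mix_orthogonal.
have : E (fun x => weight x i j * weight x i j + weight x i k * weight x i k
    + (-2) * (weight x i j * weight x i k)) <=
    E ((fun x => 4 * (weight x i j * weight x i k)) \o act_inputs (fun=> mix R j k)).
  apply: le_expect => //.
  - apply: bounded_measurableD; [apply: bounded_measurableD; exact: bww|].
    exact: (bZ _ (bww _ _ _ _)).
  - exact: bounded_measurable_act.
  - move=> x _ /=; rewrite /weight tnth_mktuple mulNr -!expr2; exact: weight_mix.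
rewrite expect_act_inputs// expectZ// !expectD ?expectZ//; last 2 first.
- by apply: bounded_measurableD; exact: bww.
- exact: (bZ _ (bww _ _ _ _)).
by move: e0; lra.
Qed.

(** Summed over all [j] and [k], the previous bound has [2 * N] times the quantity on the left, and
    on the right [6] times the expectation of [(\sum_j weight x i j) ^+ 2 = 1]. *)
Lemma expect_sum_weight_sqr i :
  E (fun x => \sum_j weight x i j * weight x i j) <= 3 / N%:R.
Proof.
rewrite expect_sum//; set F := \sum_j _.
have N1 : 0 < (N%:R : R) by rewrite ltr0n.
rewrite ler_pdivlMr//.
have : \sum_(j < N) \sum_(k < N) (E (fun x => weight x i j * weight x i j) +
    E (fun x => weight x i k * weight x i k)) <= 6 * 1.
  rewrite -[X in 6 * X](expect_cst mS P1 1).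
  rewrite (@eq_expect _ _ _ P S _
      (fun x => \sum_j \sum_k weight x i j * weight x i k))//.
    rewrite expect_sum// => [|j]; last exact: bounded_measurable_sum.
    rewrite mulr_sumr; apply: ler_sum => j _.
    rewrite expect_sum// mulr_sumr; apply: ler_sum => k _.
    exact: expect_weight_le.
  move=> x ux; under eq_bigr do rewrite -mulr_sumr sum_weight ux mulr1.
  by rewrite sum_weight ux.
under eq_bigr do rewrite big_split/= sumr_const card_ord.
rewrite big_split/= sumr_const card_ord sumrMnl -/F -[F *+ N]mulr_natr.
by set z := F * _; lra.
Qed.

(** The bound [u * w <= (u^2 + w^2) / 2] reduces this to fourth moments of single inputs, whether or
    not the two copies share an owner. *)
Lemma expect_collision (s t : 'I_T) : s != t ->
  E (fun x => \sum_(a : basis N T | a s == a t) sqmod (joint_state own x a))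
    <= 3 / N%:R.
Proof.
move=> st; rewrite (@eq_expect _ _ _ P S _ (fun x =>
  \sum_j weight x (own s) j * weight x (own t) j))//; last first.
  by move=> x ux; exact: sum_collision.
apply: (@le_trans _ _ (E (fun x => 2^-1 * \sum_j weight x (own s) j * weight x (own s) j
   + 2^-1 * \sum_j weight x (own t) j * weight x (own t) j))).
  apply: le_expect => //.
  - exact: bounded_measurable_sum.
  - by apply: bounded_measurableD; apply: bZ; exact: bounded_measurable_sum.
  - move=> x _; rewrite !mulr_sumr -big_split/=; apply: ler_sum => j _.
    by have := sqr_ge0 (weight x (own s) j - weight x (own t) j); nra.
rewrite expectD ?expectZ//; try (by exact: bounded_measurable_sum);
  try (by apply: bZ; exact: bounded_measurable_sum).
have := expect_sum_weight_sqr (own s); have := expect_sum_weight_sqr (own t).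
lra.
Qed.

Let bs a : bm (fun x => sqmod (joint_state own x a)).
Proof. exact/bounded_measurable_sqmod/cbounded_measurable_joint_state. Qed.

Lemma expect_noninjective :
  E (fun x => \sum_(a : basis N T | ~~ injectiveb a) sqmod (joint_state own x a))
    <= 3 * T%:R ^+ 2 / N%:R.
Proof.
apply: (@le_trans _ _ (E (fun x => \sum_s \sum_(t | t != s)
    \sum_(a : basis N T | a s == a t) sqmod (joint_state own x a)))).
  apply: le_expect => //.
  - exact: bounded_measurable_sum.
  - by do 3 (apply: bounded_measurable_sum => ?).
  - move=> x _; rewrite [leRHS](_ : _ = \sum_(a : basis N T) \sum_s
        \sum_(t | (t != s) && (a s == a t)) sqmod (joint_state own x a)); last first.
      rewrite [RHS]exchange_big/=; apply: eq_bigr => s _.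
      by rewrite (exchange_big_dep predT).
    rewrite [leLHS]big_mkcond/=; apply: ler_sum => a _.
    have q0 := sqmod_ge0 (joint_state own x a).
    case: ifPn => [/injectivePn[s [t st ast]]|_]; last first.
      by do 2 (apply: sumr_ge0 => ? _).
    rewrite (bigD1 s)//= (bigD1 t)/=; last by rewrite eq_sym st ast eqxx.
    rewrite -addrA lerDl addr_ge0//; first exact: sumr_ge0.
    by do 2 (apply: sumr_ge0 => ? _).
rewrite expect_sum// => [|s]; last by do 2 (apply: bounded_measurable_sum => ?).
(* Allowing [s = t] as well, at a nonnegative cost, makes the number of pairs [T ^ 2]. *)
apply: (@le_trans _ _ (\sum_(s < T) \sum_(t < T) 3 / N%:R)).
  apply: ler_sum => s _; rewrite expect_sum// => [|t];
    last exact: bounded_measurable_sum.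
  rewrite big_mkcond/=; apply: ler_sum => t _; case: ifPn => [ts|_].
    by apply: expect_collision; rewrite eq_sym.
  by rewrite divr_ge0.
by rewrite !sumr_const card_ord -mulrnA -[_ *+ (T * T)]mulr_natr natrM -expr2 mulrAC.
Qed.

(** A permutation of the coordinates carries one amplitude to the other and preserves the law. *)
Lemma expect_sqmod_injective a b : injectiveb a -> injectiveb b ->
  E (fun x => sqmod (joint_state own x a)) =
  E (fun x => sqmod (joint_state own x b)).
Proof.
move=> ia ib; have [s hs] := joint_state_permute R own ia ib.
rewrite -(expect_act_inputs (permute_orthogonal R s))//.
by apply: eq_expect => x _ /=; rewrite hs.
Qed.

Lemma bounded_measurable_entry a b (m : R[i]) :
  bm (fun x => complex.Re (conjc (joint_state own x a) * m * joint_state own x b)).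
Proof.
have h c := cbounded_measurable_joint_state c.
have [] // := cbounded_measurableM (cbounded_measurableM
  (cbounded_measurable_conj (h a)) (cbounded_measurable_cst m)) (h b).
Qed.

(* If some entry (i, j) occurs in only one of the two products, flipping its
   sign turns the integrand into its opposite. *)
Lemma expect_entry a b (m : R[i]) : injectiveb a -> injectiveb b ->
  E (fun x => complex.Re (conjc (joint_state own x a) * m * joint_state own x b))
  = (used own a == used own b)%:R *
    (complex.Re m * E (fun x => sqmod (joint_state own x a))).
Proof.
move=> ia ib; have [ab|ab] := eqVneq.
  rewrite mul1r -expectZ//; apply: eq_expect => x _.
  have -> : joint_state own x b = joint_state own x a.
    by rewrite !joint_state_used// ab.
  exact: Re_conj_mul.
rewrite mul0r.
have [[i j] pa pb] : exists2 p, p \in used own a & p \notin used own b.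
  (* Both sets have [T] elements, so an inclusion would be an equality. *)
  apply/subsetPn; apply: contra ab => sab.
  by rewrite eqEcard sab !card_used ?leqnn.
pose h x := complex.Re (conjc (joint_state own x a) * m * joint_state own x b).
rewrite -[LHS]/(E h); have bh : bm h by exact: bounded_measurable_entry.
have : E (h \o act_inputs (flip R i j)) = E (fun x => -1 * h x).
  apply: eq_expect => x _; rewrite /h /= !joint_state_flip// pa (negbTE pb).
  by rewrite expr1 expr0 mul1r !mulN1r rmorphN !mulNr raddfN.
rewrite expect_act_inputs ?expectZ//; last exact: flip_orthogonal.
by lra.
Qed.

End joint_state_expectations.

(** * Quadratic forms of measurement operators *)

Section quadratic_forms.
Variables (R : realType) (C N T : nat).
Implicit Types (M : operator R N T) (v c p : basis N T -> R[i]).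

Definition qform M v : R :=
  complex.Re (\sum_a \sum_b conjc (v a) * M a b * v b).

Lemma qformE M v :
  qform M v = \sum_a \sum_b complex.Re (conjc (v a) * M a b * v b).
Proof. by rewrite /qform raddf_sum; apply: eq_bigr => a _; rewrite raddf_sum. Qed.

(* Q (c + p) + Q (c - 2 p) / 2 = 3/2 Q c + 3 Q p *)
Lemma qform_split M c p : psd M ->
  qform M (fun a => c a + p a) <= 3 / 2 * qform M c + 3 * qform M p.
Proof.
move=> [_ M0].
have -> : 3 / 2 * qform M c + 3 * qform M p =
   qform M (fun a => c a + p a) + 2^-1 * qform M (fun a => c a - 2 * p a).
  rewrite !qformE !mulr_sumr -!big_split/=; apply: eq_bigr => a _.
  rewrite !mulr_sumr -!big_split/=; apply: eq_bigr => b _.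
  case: (c a) (p a) (M a b) (c b) (p b) => [? ?] [? ?] [? ?] [? ?] [? ?] /=.
  by field.
by have := M0 (fun a => c a - 2 * p a); rewrite -/(qform _ _); lra.
Qed.

(** The forms of all outcomes are nonnegative and add up to the squared norm. *)
Lemma qform_le (M : 'I_C -> operator R N T) v k : POVM M ->
  qform (M k) v <= \sum_a sqmod (v a).
Proof.
move=> [M0 M1].
have <- : \sum_l qform (M l) v = \sum_a sqmod (v a).
  under eq_bigr do rewrite qformE.
  rewrite exchange_big/=; apply: eq_bigr => a _.
  rewrite exchange_big/= (bigD1 a)//= [X in _ + X]big1 => [|b /negbTE ba].
    rewrite addr0 -raddf_sum -mulr_suml -mulr_sumr M1 eqxx.
    by apply: etrans (Re_conj_mul _ _) _; rewrite /= mul1r.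
  by rewrite -raddf_sum -mulr_suml -mulr_sumr M1 eq_sym ba mulr0 mul0r.
rewrite (bigD1 k)//= lerDl; apply: sumr_ge0 => l _.
by have [_ h] := M0 l; exact: h.
Qed.

End quadratic_forms.

(** * Bounding the probability of one outcome *)

Section success_probability.
Variables (R : realType) (C N T : nat) (own : 'I_T -> 'I_C).

(** Up to the factor [q], the trace of [M] against the averaged injective part of the state: only
    entries between indices with the same [used] set survive averaging. *)
Definition diagonal_trace (M : operator R N T) : R :=
  \sum_(a : basis N T | injectiveb a)
  \sum_(b : basis N T | injectiveb b && (used own a == used own b))
    complex.Re (M a b).

(** Summing over the outcomes replaces [M] by the identity, which keeps only the pairs [a = b]. *)
Lemma sum_diagonal_trace (M : 'I_C -> operator R N T) : POVM M ->
  \sum_k diagonal_trace (M k) = #|[pred a : basis N T | injectiveb a]|%:R.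
Proof.
move=> [_ M1]; rewrite exchange_big/= -sum1_card natr_sum.
apply: eq_bigr => a ia; rewrite exchange_big/= (bigD1 a)/= ?ia ?eqxx//.
rewrite -raddf_sum M1 eqxx [X in _ + X]big1 ?addr0// => b /andP[_ /negbTE ba].
by rewrite -raddf_sum M1 eq_sym ba.
Qed.

(** Here [q] is the common mean of the squared amplitudes at injective indices; the state has norm
    [1], hence the bound on [q]. The error is [3] times the noninjective mass, itself at most
    [3 * T ^ 2 / N]. *)
Lemma outcome_prob_le (P : probability (inputs R C N) R)
    (M : 'I_C -> operator R N T) k :
  (0 < N)%N -> P (@unit_inputs R N C) = 1%E ->
  (forall O : 'I_C -> 'M[R]_N, (forall i, orthogonal (O i)) ->
    forall X, measurable X -> P (act_inputs O @^-1` X) = P X) ->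
  POVM M ->
  exists q : R, [/\ 0 <= q,
    q * #|[pred a : basis N T | injectiveb a]|%:R <= 1 &
    (outcome_prob own P (M k) <=
     (3 / 2 * (q * diagonal_trace (M k)) + 9 * T%:R ^+ 2 / N%:R)%:E)%E].
Proof.
move=> N0 P1 Pinv PM.
pose S := @unit_inputs R N C.
have mS : measurable S by exact: measurable_unit_inputs.
pose psi (x : inputs R C N) (a : basis N T) := joint_state own x a.
have bs a : bounded_measurable S (fun x => sqmod (psi x a)).
  exact/bounded_measurable_sqmod/cbounded_measurable_joint_state.
have be a b m : bounded_measurable S
    (fun x => complex.Re (conjc (psi x a) * m * psi x b)).
  exact: bounded_measurable_entry.
have s0 a : 0 <= expect P S (fun x => sqmod (psi x a)).
  rewrite -(expect_cst mS P1 0); apply: le_expect => //.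
    exact: bounded_measurable_cst.
  by move=> x _; exact: sqmod_ge0.
have [q [q0 hq]] : exists q : R, 0 <= q /\ forall a : basis N T, injectiveb a ->
    expect P S (fun x => sqmod (psi x a)) = q.
  have [a ia|no] := pickP [pred a : basis N T | injectiveb a].
    exists (expect P S (fun x => sqmod (psi x a))); split => // b ib.
    exact: expect_sqmod_injective.
  (* If there is no injective index, [q = 0] will do. *)
  by exists 0; split => // a ia; have := no a; rewrite /= ia.
exists q; split => //.
  rewrite -sum1_card natr_sum mulr_sumr -[leRHS](expect_cst mS P1).
  rewrite (eq_bigr (fun a => expect P S (fun x => sqmod (psi x a)))); last first.
    by move=> a ia; rewrite mulr1 hq.
  rewrite -expect_sum//; apply: le_expect => //.
  - exact: bounded_measurable_sum.
  - exact: bounded_measurable_cst.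
  - move=> x ux; rewrite /cst -(sum_sqmod_joint_state own ux).
    rewrite [leRHS](bigID (fun a : basis N T => injectiveb a))/=.
    by rewrite lerDl; apply: sumr_ge0 => a _; exact: sqmod_ge0.
pose good (x : inputs R C N) :=
  \sum_(a : basis N T | injectiveb a) \sum_(b : basis N T | injectiveb b)
  complex.Re (conjc (psi x a) * M k a b * psi x b).
pose bad (x : inputs R C N) :=
  \sum_(a : basis N T | ~~ injectiveb a) sqmod (psi x a).
have bgood : bounded_measurable S good by do 2 (apply: bounded_measurable_sum => ?).
have bbad : bounded_measurable S bad by exact: bounded_measurable_sum.
have bq : bounded_measurable S (fun x => qform (M k) (psi x)).
  under [X in bounded_measurable _ X]funext do rewrite qformE.
  by do 2 (apply: bounded_measurable_sum => ?).
have bZ (c : R) h : bounded_measurable S h -> bounded_measurable S (fun x => c * h x).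
  by move=> bh; apply: bounded_measurableM bh; exact: bounded_measurable_cst.
rewrite /outcome_prob (integral_expect mS P1 bq) lee_fin.
apply: (@le_trans _ _ (expect P S (fun x => 3 / 2 * good x + 3 * bad x))).
  apply: le_expect => //; first by apply: bounded_measurableD; exact: bZ.
  (* [c] and [p] are the injective and noninjective parts of the state; [qform_split] removes the
     cross terms between them. *)
  move=> x _; pose c (a : basis N T) := if injectiveb a then psi x a else 0.
  pose p (a : basis N T) := if injectiveb a then 0 else psi x a.
  have -> : psi x = (fun a => c a + p a).
    by apply/funext => a; rewrite /c /p; case: ifP; rewrite ?addr0 ?add0r.
  have [M0 _] := PM.
  apply: (le_trans (qform_split _ _ (M0 k))); rewrite lerD//.
    rewrite ler_pM2l ?divr_gt0// le_eqVlt; apply/orP; left; apply/eqP.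
    rewrite qformE [RHS]big_mkcond/=; apply: eq_bigr => a _; rewrite /c.
    case: ifP => _; last by rewrite big1// => b _; rewrite conjc0 !mul0r.
    rewrite [RHS]big_mkcond/=; apply: eq_bigr => b _.
    by case: ifP => //; rewrite mulr0.
  rewrite ler_pM2l//; apply: (le_trans (qform_le _ _ PM)).
  rewrite /bad [leRHS]big_mkcond/=; apply: ler_sum => a _; rewrite /p.
  by case: ifP => //= _; rewrite /sqmod /= expr0n addr0.
rewrite expectD ?expectZ//; try exact: bZ.
apply: lerD; last first.
  have := expect_noninjective own N0 P1 Pinv; rewrite -/S -/bad; lra.
rewrite ler_pM2l ?divr_gt0// /good expect_sum// => [|a];
  last exact: bounded_measurable_sum.
rewrite mulr_sumr; apply: ler_sum => a ia.
rewrite expect_sum// [in leRHS]big_mkcondr mulr_sumr; apply: ler_sum => b ib.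
rewrite expect_entry// hq//; case: eqP => _; last by rewrite mul0r mulr0.
by rewrite mul1r mulrC.
Qed.

End success_probability.

(** * Contradiction from too few copies *)

Theorem theorem1 :
  forall (R : realType) (C : nat), (2 <= C)%N ->
  exists c : R, 0 < c /\
  exists n0 : nat, forall n : nat, (n0 <= n)%N ->
  forall (T : nat) (own : 'I_T -> 'I_C) (M : 'I_C -> operator R (2 ^ n) T),
    POVM M ->
    (forall (kstar : 'I_C) (P : probability (inputs R C (2 ^ n)) R),
        rvs_distribution kstar P ->
        ((9 / 10 : R)%:E <= outcome_prob own P (M kstar))%E) ->
    c * Num.sqrt (2 ^+ n : R) <= T%:R.
Proof.
(* With [T < sqrt N / 10] the error [9 * T ^ 2 / N] is below [9 / 100], so success [9 / 10] forces
   [q * X > 54 / 100], where [X] is the [diagonal_trace]. All that is used is [q * X > 1 / 2]. *)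
move=> R C C2; exists (1 / 10); split; first by lra.
exists 0%N => n _ T own M PM hM.
rewrite leNgt; apply/negP => Tsmall.
set N := (2 ^ n)%N in M PM hM *.
have N0 : (0 < N)%N by rewrite expn_gt0.
have NR : 0 < (N%:R : R) by rewrite ltr0n.
have T2 : (T%:R : R) ^+ 2 / N%:R < 1 / 100.
  rewrite ltr_pdivrMr//.
  have sN : Num.sqrt (2 ^+ n : R) ^+ 2 = N%:R.
    by rewrite sqr_sqrtr ?exprn_ge0// /N natrX.
  rewrite -sN; have := sqrtr_ge0 (2 ^+ n : R); have : 0 <= (T%:R : R) by [].
  by move: Tsmall; nra.
pose D : R := #|[pred a : basis N T | injectiveb a]|%:R.
have half k : D / 2 < diagonal_trace own (M k).
  have [P [rP P1 Pinv]] := @rvs_distribution_exists R N N0 C k.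
  have [q [q0 qD hq]] := outcome_prob_le own k N0 P1 Pinv PM.
  have := le_trans (hM k P rP) hq; rewrite lee_fin => h.
  rewrite -/D in qD.
  have qX : 1 < 2 * (q * diagonal_trace own (M k)) by lra.
  (* If [X <= D / 2] then [q * X <= q * D / 2 <= 1 / 2]. *)
  rewrite ltNge; apply/negP => XD.
  have : q * diagonal_trace own (M k) <= q * (D / 2) by exact: ler_wpM2l.
  lra.
have D0 : 0 <= D by exact: ler0n.
have := sum_diagonal_trace own PM; rewrite -/D => sumD.
have C0 : (0 < C)%N by exact: leq_trans C2.
(* The right side is [D] and the left side is [C * D / 2], at least [D] since [C >= 2]. *)
have : \sum_(k < C) D / 2 < \sum_(k < C) diagonal_trace own (M k).
  by apply: ltr_sum => //; apply/hasP; exists (Ordinal C0).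
rewrite sumD sumr_const card_ord -mulr_natr => lt.
have : (2 : R) <= C%:R by rewrite ler_nat.
by move: lt D0; nra.
Qed.
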